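(* Let $P$ be an ergodic hyperbounded Markov operator on a probability space $(S,\Sigma,\mu)$ mapping $L^2(\mu)$ to $L^4(\mu)$. If $\|P\|_{L^2\to L^4}<2^{1/4}$, then $P$ is aperiodic.
   Context: Let $(S,\Sigma,\mu)$ be a probability space and $P(x,A)$ a transition probability on $S\times\Sigma$, with Markov operator $Pf(x)=\int f(y)P(x,dy)$. $P$ is bi-stochastic if $\int P(x,A)\,d\mu(x)=\mu(A)$ for all $A\in\Sigma$; then $P$ induces a contraction of every $L^p(\mu)$. $P$ is hyperbounded if it is bi-stochastic and maps $L^p(\mu)$ into $L^q(\mu)$ for some $1<p<q\le\infty$. $P$ is ergodic if $Pf=f\in L^\infty(\mu)$ implies $f$ is constant a.e. A hyperbounded $P$ is quasi-compact in every complex $L^r(\mu)$, $1<r<\infty$ (i.e. some power is at operator-norm distance less than 1 from a compact operator); $\sigma(P)\cap\mathbb T$ is then a finite set of roots of unity, all of them eigenvalues, and the period of $P$ is the smallest integer $d\ge1$ such that $\lambda^d=1$ for every $\lambda\in\sigma(P)\cap\mathbb T$ (it does not depend on $r$). $P$ is aperiodic if its period is $d=1$. *)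

(* Defs.v *)
From HB Require Import structures.
From mathcomp Require Import all_boot all_order all_algebra.
From mathcomp Require Import all_classical all_reals all_analysis.
From mathcomp Require Import complex.

Set Implicit Arguments.
Unset Strict Implicit.
Unset Printing Implicit Defensive.
Import Order.TTheory GRing.Theory Num.Theory.
Import numFieldNormedType.Exports.

Local Open Scope classical_set_scope.
Local Open Scope ring_scope.

Section MarkovOperator.
Context {d : measure_display} {S : measurableType d} {R : realType}.
Variables (mu : probability S R) (P : R.-pker S ~> S).

(* For mu-integrable f the integral converges at mu-almost every x when P is
   bi-stochastic; on the exceptional null set Rintegral yields a junk value. *)
Definition markov_op (f : S -> R) : S -> R := fun x => \int[P x]_y f y.

Definition bistochastic : Prop :=
  forall A : set S, measurable A -> (\int[mu]_x P x A = mu A)%E.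

Definition maps_Lp (p q : \bar R) : Prop :=
  forall f : S -> R, f \in Lfun mu p -> markov_op f \in Lfun mu q.

Definition hyperbounded : Prop :=
  bistochastic /\
  exists p q : \bar R, [/\ (1 < p)%E, (p < q)%E & maps_Lp p q].

Definition ergodic : Prop :=
  forall f : S -> R, f \in Lfun mu +oo%E ->
    {ae mu, forall x, markov_op f x = f x} ->
    exists c : R, {ae mu, forall x, f x = c}.

Definition opnorm (p q : \bar R) : \bar R :=
  ereal_sup [set Lnorm mu q (EFin \o markov_op f) | f in
    [set f : S -> R | f \in Lfun mu p /\ (Lnorm mu p (EFin \o f) <= 1)%E]].

(* Elements of the complex L^p space are handled as functions S -> R[i], the
   identification of almost everywhere equal functions being made explicit. *)
Definition LnormC (p : \bar R) (f : S -> R[i]) : \bar R :=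
  Lnorm mu p (fun x => (Normc.normc (f x))%:E).

Definition LfunC (p : \bar R) (f : S -> R[i]) : Prop :=
  [/\ measurable_fun setT (fun x => complex.Re (f x)),
      measurable_fun setT (fun x => complex.Im (f x)) &
      (LnormC p f < +oo)%E].

Definition markov_opC (f : S -> R[i]) : S -> R[i] := fun x =>
  Complex (markov_op (fun y => complex.Re (f y)) x)
          (markov_op (fun y => complex.Im (f y)) x).

Definition ae_eqC (f g : S -> R[i]) : Prop := {ae mu, forall x, f x = g x}.

Definition bounded_operator (p : \bar R)
    (T : (S -> R[i]) -> (S -> R[i])) : Prop :=
  [/\ forall f, LfunC p f -> LfunC p (T f),
      forall f g, LfunC p f -> LfunC p g -> ae_eqC f g -> ae_eqC (T f) (T g),
      forall (a : R[i]) f g, LfunC p f -> LfunC p g ->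
        ae_eqC (T (fun x => a * f x + g x)) (fun x => a * T f x + T g x) &
      exists M : R, forall f, LfunC p f ->
        (LnormC p (T f) <= M%:E * LnormC p f)%E].

Definition invertible_operator (p : \bar R)
    (A : (S -> R[i]) -> (S -> R[i])) : Prop :=
  exists2 T, bounded_operator p T &
    forall f, LfunC p f -> ae_eqC (T (A f)) f /\ ae_eqC (A (T f)) f.

Definition spectrum (p : \bar R) : set R[i] :=
  [set l | ~ invertible_operator p (fun f x => l * f x - markov_opC f x)].

Definition peripheral_spectrum (p : \bar R) : set R[i] :=
  spectrum p `&` [set l | `|l| = 1].

Definition is_period (p : \bar R) (n : nat) : Prop :=
  [/\ (0 < n)%N,
      forall l, peripheral_spectrum p l -> l ^+ n = 1 &
      forall m : nat, (0 < m)%N ->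
        (forall l, peripheral_spectrum p l -> l ^+ m = 1) -> (n <= m)%N].

(* For a hyperbounded operator the period is the same on every L^r,
   1 < r < oo; no exponent is singled out. *)
Definition aperiodic : Prop := forall r : R, 1 < r -> is_period r%:E 1.

End MarkovOperator.

(* Main.v *)
Require Import Defs.
From HB Require Import structures.
From mathcomp Require Import all_boot all_order all_algebra.
From mathcomp Require Import all_classical all_reals all_analysis.
From mathcomp Require Import complex.
From mathcomp Require Import measurable_realfun giry ring lra.

(** If [u] has mean zero and [s] is its L^2 norm, both functions [s + u] and
    [s - u] have squared L^2 norm [2 s^2], while the fourth powers of [s + Pu]
    and [s - Pu] add up to [2 s^4 + 12 s^2 (Pu)^2 + 2 (Pu)^4].  Bounding both
    L^4 norms by the L^2 -> L^4 norm [N] of [P] gives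
    [|Pu|_2^2 <= (N^4 / 2) |u|_2^2], so [P] is a strict contraction on the mean
    zero part of L^2 as soon as [N^4 < 2]; ergodicity is then automatic.

    The decay of [P^n] passes to every L^r with [1 < r < oo] by positivity:
    integrating [y <= t^(1-a) y^a + t^(1-b) y^b] (for [b <= 1 <= a]) against
    [P x] and choosing the level [t] as a function of [x], the L^2 -> L^4 bound
    makes [P] map L^r to L^q with a definite gain [q - r], so some power of [P]
    maps L^r to L^2 and some power maps L^2 to L^r.  Hence the Neumann series of
    the resolvent at any unimodular [lam <> 1] converges on mean zero functions,
    constants being treated separately, and [lam] is not in the spectrum. *)

Import Order.TTheory GRing.Theory Num.Theory.
Import numFieldNormedType.Exports.
Local Open Scope classical_set_scope.
Local Open Scope ring_scope.

Set Implicit Arguments.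
Unset Strict Implicit.
Unset Printing Implicit Defensive.

(** * Real L^p norms *)

(** The swap of two atoms of mass 1/2 shows where 2^(1/4) comes from: it has period 2, and its L^2
    -> L^4 norm is exactly 2^(1/4), attained at the indicator of one atom, which up to scaling is
    [s + u] with [u] equal to 1 and -1 on the atoms. In that case the gap estimate is an equality.

    The gap lives in L^2, whereas [aperiodic] quantifies over every exponent r > 1. The smoothing
    exponents are those of Riesz-Thorin interpolation of the L^2 -> L^4 bound with L^1 -> L^1 (r <
    2) or L^oo -> L^oo (r >= 2); splitting [y] reaches them by real-variable means. Constants may be
    lost on the way, since only a fixed number of iterates lies outside the L^2 estimate.

    A second difficulty is that [spectrum] speaks of functions, not of classes: [markov_op] is
    linear only almost everywhere, because of junk values on null sets, and the inverse operator
    must be a map on functions, picked by choice. Its linearity and its compatibility with almost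
    everywhere equality then come from uniqueness of the limit of the Neumann series. *)

Section NonnegativeIntegrals.
Context {d : measure_display} {S : measurableType d} {R : realType}.
Variable m : {measure set S -> \bar R}.
Implicit Types f g : S -> R.

Lemma ae_ge0_le_int f g : measurable_fun setT f -> measurable_fun setT g ->
  (forall x, 0 <= f x) -> (forall x, 0 <= g x) ->
  {ae m, forall x, f x <= g x} ->
  (\int[m]_x (f x)%:E <= \int[m]_x (g x)%:E)%E.
Proof.
move=> mf mg f0 g0 fg; apply: ae_ge0_le_integral => //.
- by move=> x _; rewrite lee_fin f0.
- exact/measurable_EFinP.
- by move=> x _; rewrite lee_fin g0.
- exact/measurable_EFinP.
by apply: filterS fg => x fgx _; rewrite lee_fin.
Qed.

Lemma ge0_le_int f g : measurable_fun setT f -> measurable_fun setT g ->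
  (forall x, 0 <= f x) -> (forall x, f x <= g x) ->
  (\int[m]_x (f x)%:E <= \int[m]_x (g x)%:E)%E.
Proof.
move=> mf mg f0 fg; apply: ae_ge0_le_int => //.
  by move=> x; rewrite (le_trans (f0 x)).
exact: aeW.
Qed.

Lemma ge0_intD f g : measurable_fun setT f -> measurable_fun setT g ->
  (forall x, 0 <= f x) -> (forall x, 0 <= g x) ->
  (\int[m]_x (f x + g x)%:E = \int[m]_x (f x)%:E + \int[m]_x (g x)%:E)%E.
Proof.
move=> mf mg f0 g0; under eq_integral do rewrite EFinD.
rewrite ge0_integralD//.
- by move=> x _; rewrite lee_fin f0.
- exact/measurable_EFinP.
- by move=> x _; rewrite lee_fin g0.
- exact/measurable_EFinP.
Qed.

Lemma ge0_intZ c f : measurable_fun setT f -> 0 <= c -> (forall x, 0 <= f x) ->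
  (\int[m]_x (c * f x)%:E = c%:E * \int[m]_x (f x)%:E)%E.
Proof.
move=> mf c0 f0; under eq_integral do rewrite EFinM.
rewrite ge0_integralZl//.
- exact/measurable_EFinP.
- by move=> x _; rewrite lee_fin f0.
Qed.

Lemma measurable_powR_abs p f :
  measurable_fun setT f -> measurable_fun setT (fun x => `|f x| `^ p).
Proof.
by move=> mf; apply: (measurableT_comp (measurable_powR p)); exact: measurableT_comp.
Qed.

End NonnegativeIntegrals.

Section LpNorm.
Context {d : measure_display} {S : measurableType d} {R : realType}.
Variable mu : probability S R.
Implicit Types (p q c : R) (u v : S -> R).

Lemma int_cst c : (\int[mu]_x c%:E = c%:E)%E.
Proof. by rewrite integral_cst// -[RHS]mule1; congr mule; exact: probability_setT. Qed.

(** [fine] sends an infinite norm to 0, so an upper bound on [Lpnorm] carries information only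
    together with membership in [Lfun]; this is why the two are usually concluded jointly. *)
Definition Lpnorm p u : R := fine (Lnorm mu p%:E (EFin \o u)).

Lemma LfunP_lty p u : u \in Lfun mu p%:E <->
  measurable_fun setT u /\ (Lnorm mu p%:E (EFin \o u) < +oo)%E.
Proof.
split.
  by rewrite inE => /andP[]; rewrite !inE.
by move=> [mu' fu]; rewrite inE; apply/andP; rewrite !inE.
Qed.

Lemma measurable_Lfun p u : u \in Lfun mu p%:E -> measurable_fun setT u.
Proof. by case/LfunP_lty. Qed.

Lemma Lpnorm_ge0 p u : 0 <= Lpnorm p u.
Proof. by rewrite fine_ge0// Lnorm_ge0. Qed.

Lemma LpnormE p u : u \in Lfun mu p%:E -> (Lpnorm p u)%:E = Lnorm mu p%:E (EFin \o u).
Proof. by case/LfunP_lty => _ fu; rewrite fineK// ge0_fin_numE ?Lnorm_ge0. Qed.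

Lemma Lpnorm_int p u : 1 <= p -> u \in Lfun mu p%:E ->
  (\int[mu]_x (`|u x| `^ p)%:E = (Lpnorm p u `^ p)%:E)%E.
Proof.
move=> p1 Lu; rewrite -poweR_EFin LpnormE// powR_Lnorm//.
by rewrite gt_eqF// (lt_le_trans ltr01).
Qed.

Lemma Lpnorm_le p u c : 1 <= p -> measurable_fun setT u -> 0 <= c ->
  (\int[mu]_x (`|u x| `^ p)%:E <= (c `^ p)%:E)%E ->
  u \in Lfun mu p%:E /\ Lpnorm p u <= c.
Proof.
move=> p1 mfu c0 h; have p0 : 0 < p by rewrite (lt_le_trans ltr01).
have hL : (Lnorm mu p%:E (EFin \o u) <= c%:E)%E.
  rewrite unlock -[leRHS](_ : ((c `^ p)%:E `^ p^-1)%E = _); last first.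
    by rewrite poweR_EFin -powRrM mulfV ?gt_eqF// powRr1.
  apply: gt0_ler_poweR => //; first by rewrite invr_ge0 ltW.
  - by rewrite in_itv/= leey andbT; apply: integral_ge0 => x _; rewrite lee_fin powR_ge0.
  - by rewrite in_itv/= leey andbT lee_fin powR_ge0.
have Lu : u \in Lfun mu p%:E by apply/LfunP_lty; split => //; exact: (le_lt_trans hL (ltry _)).
by split => //; rewrite -lee_fin LpnormE.
Qed.

Lemma Lpnorm_le_ae p u v : 1 <= p -> v \in Lfun mu p%:E -> measurable_fun setT u ->
  {ae mu, forall x, `|u x| <= `|v x|} -> u \in Lfun mu p%:E /\ Lpnorm p u <= Lpnorm p v.
Proof.
move=> p1 Lv mfu uv; apply: Lpnorm_le => //; first exact: Lpnorm_ge0.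
rewrite -(Lpnorm_int p1 Lv); apply: ae_ge0_le_int => //.
- exact: measurable_powR_abs.
- exact/measurable_powR_abs/measurable_Lfun/Lv.
apply: filterS uv => x uvx; rewrite ge0_ler_powR ?nnegrE//.
by rewrite (le_trans ler01).
Qed.

Lemma Lpnorm_congr p u v : 1 <= p -> v \in Lfun mu p%:E -> measurable_fun setT u ->
  {ae mu, forall x, u x = v x} -> u \in Lfun mu p%:E /\ Lpnorm p u = Lpnorm p v.
Proof.
move=> p1 Lv mfu uv.
have [|Lu h1] := Lpnorm_le_ae p1 Lv mfu; first by apply: filterS uv => x ->.
have [|_ h2] := Lpnorm_le_ae p1 Lu (measurable_Lfun Lv); first by apply: filterS uv => x ->.
by split => //; apply/eqP; rewrite eq_le h1 h2.
Qed.

Lemma LpnormD p u v : 1 <= p -> u \in Lfun mu p%:E -> v \in Lfun mu p%:E ->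
  (fun x => u x + v x) \in Lfun mu p%:E /\
  Lpnorm p (fun x => u x + v x) <= Lpnorm p u + Lpnorm p v.
Proof.
move=> p1 Lu Lv.
have := minkowski_EFin mu (measurable_Lfun Lu) (measurable_Lfun Lv) p1.
rewrite -(LpnormE Lu) -(LpnormE Lv) -EFinD => h.
have L : (fun x => u x + v x) \in Lfun mu p%:E.
  apply/LfunP_lty; split; last exact: (le_lt_trans h (ltry _)).
  by apply: measurable_funD; apply: measurable_Lfun; [exact: Lu|exact: Lv].
by split => //; rewrite -lee_fin LpnormE.
Qed.

Lemma LpnormZ_le p u c : 1 <= p -> u \in Lfun mu p%:E ->
  (fun x => c * u x) \in Lfun mu p%:E /\
  Lpnorm p (fun x => c * u x) <= `|c| * Lpnorm p u.
Proof.
move=> p1 Lu; apply: Lpnorm_le => //.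
- by apply: measurable_funM => //; exact: measurable_Lfun Lu.
- by rewrite mulr_ge0// Lpnorm_ge0.
under eq_integral do rewrite normrM powRM//.
rewrite ge0_intZ// ?powR_ge0//.
  by rewrite Lpnorm_int// -EFinM powRM// Lpnorm_ge0.
exact/measurable_powR_abs/measurable_Lfun/Lu.
Qed.

Lemma LpnormZ p u c : 1 <= p -> u \in Lfun mu p%:E ->
  Lpnorm p (fun x => c * u x) = `|c| * Lpnorm p u.
Proof.
move=> p1 Lu; have [Lcu h] := LpnormZ_le c p1 Lu.
apply/eqP; rewrite eq_le h /=.
have [->|c0] := eqVneq c 0; first by rewrite normr0 mul0r Lpnorm_ge0.
(* The reverse inequality is the first one applied with the factor [c^-1]. *)
have [_] := LpnormZ_le c^-1 p1 Lcu.
under [X in Lpnorm p X <= _]eq_fun do rewrite mulKf//.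
by rewrite normfV ler_pdivlMl// normr_gt0.
Qed.

Lemma LpnormB p u v : 1 <= p -> u \in Lfun mu p%:E -> v \in Lfun mu p%:E ->
  (fun x => u x - v x) \in Lfun mu p%:E /\
  Lpnorm p (fun x => u x - v x) <= Lpnorm p u + Lpnorm p v.
Proof.
move=> p1 Lu Lv; have [Lw h] := LpnormZ_le (-1) p1 Lv.
have [L h'] := LpnormD p1 Lu Lw.
have E : (fun x => u x - v x) = (fun x => u x + -1 * v x).
  by apply/funext => x; rewrite mulN1r.
rewrite E; split => //; apply: (le_trans h').
by rewrite lerD2l (le_trans h)// normrN1 mul1r.
Qed.

Lemma Lpnorm_cst p c : 1 <= p -> (fun=> c) \in Lfun mu p%:E /\ Lpnorm p (fun=> c) <= `|c|.
Proof.
move=> p1; apply: Lpnorm_le => //.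
by rewrite int_cst.
Qed.

Lemma Lpnorm_eq0 p u : 1 <= p -> u \in Lfun mu p%:E -> Lpnorm p u = 0 ->
  {ae mu, forall x, u x = 0}.
Proof.
move=> p1 Lu u0.
have := @Lnorm_eq0_eq0 _ _ _ mu (EFin \o u) p%:E.
rewrite -LpnormE// u0 lte_fin => /(_ _ _ erefl) h.
have {}h := h ((measurable_EFinP _ _).2 (measurable_Lfun Lu)) (lt_le_trans ltr01 p1).
by apply: filterS h => x /(_ I) [].
Qed.

(** Rescaling to the unit ball. Homogeneity is asked for only almost everywhere, as that is all
    [markov_op] satisfies; measurability of [T u] lets norms pass across that almost everywhere
    equality. *)
Lemma bounded_of_ball p q (T : (S -> R) -> S -> R) C : 1 <= p -> 1 <= q -> 0 <= C ->
  (forall c u, u \in Lfun mu p%:E ->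
    {ae mu, forall x, T (fun y => c * u y) x = c * T u x}) ->
  (forall u, u \in Lfun mu p%:E -> measurable_fun setT (T u)) ->
  (forall u, u \in Lfun mu p%:E -> Lpnorm p u <= 1 ->
    T u \in Lfun mu q%:E /\ Lpnorm q (T u) <= C) ->
  forall u, u \in Lfun mu p%:E -> T u \in Lfun mu q%:E /\ Lpnorm q (T u) <= C * Lpnorm p u.
Proof.
move=> p1 q1 C0 hom meas ball u Lu.
(* The factor is left free: it is the inverse of the norm of [u] when this is nonzero, and can be
   taken large otherwise. *)
have scaled c : c != 0 -> `|c| * Lpnorm p u <= 1 ->
    T u \in Lfun mu q%:E /\ `|c| * Lpnorm q (T u) <= C.
  move=> c0 cu; have [Lcu _] := LpnormZ_le c p1 Lu.
  have [Lw w] : T (fun y => c * u y) \in Lfun mu q%:E /\ Lpnorm q (T (fun y => c * u y)) <= C.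
    by apply: ball => //; rewrite LpnormZ.
  have mcT : measurable_fun setT (fun x => c * T u x).
    by apply: measurable_funM => //; exact: meas.
  have [|LcT e] := Lpnorm_congr q1 Lw mcT.
    by apply: filterS (hom c u Lu) => x ->.
  have [LT _] := LpnormZ_le c^-1 q1 LcT.
  have E : (fun x => c^-1 * (c * T u x)) = T u by apply/funext => x; rewrite mulKf.
  rewrite E in LT; split => //.
  by rewrite -(LpnormZ c q1 LT) e.
have [u0|u0] := eqVneq (Lpnorm p u) 0; last first.
  have u0' : 0 < Lpnorm p u by rewrite lt0r u0 Lpnorm_ge0.
  have [||LT] := scaled (Lpnorm p u)^-1.
  - by rewrite invr_eq0.
  - by rewrite normfV gtr0_norm// mulVf.
  by rewrite normfV gtr0_norm// ler_pdivrMl// mulrC.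
have [||LT h] := scaled 1; [by rewrite oner_eq0|by rewrite u0 mulr0|].
split => //; rewrite u0 mulr0 leNgt; apply/negP => T0.
(* All multiples of a [u] of norm 0 stay in the ball; the image of this one would have norm
   [C + 1]. *)
have [||_] := scaled ((C + 1) / Lpnorm q (T u)).
- by rewrite mulf_neq0 ?invr_eq0 ?gt_eqF// ltr_wpDl.
- by rewrite u0 mulr0.
rewrite ger0_norm; last by rewrite divr_ge0 ?Lpnorm_ge0// addr_ge0.
by rewrite divfK ?gt_eqF// leNgt ltrDl ltr01.
Qed.

(* |u|^p <= 1 + |u|^q, up to a constant that homogeneity makes harmless. *)
Lemma Lpnorm_embed p q : 1 <= p -> p <= q -> exists2 C, 0 <= C &
  forall u, u \in Lfun mu q%:E -> u \in Lfun mu p%:E /\ Lpnorm p u <= C * Lpnorm q u.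
Proof.
move=> p1 pq; have q1 := le_trans p1 pq; have p0 : 0 < p by rewrite (lt_le_trans ltr01).
have pow1 (s : R) : 1 `^ s = 1 :> R by rewrite powR1.
exists 2 => //; apply: (@bounded_of_ball q p id) => //; first by move=> c u _; exact: aeW.
  by move=> u /measurable_Lfun.
move=> v Lv v1; have mv := measurable_Lfun Lv.
apply: Lpnorm_le => //.
have mvq := @measurable_powR_abs _ _ _ q _ mv.
apply: (@le_trans _ _ (\int[mu]_x (1 + `|v x| `^ q)%:E)%E).
  apply: ge0_le_int => //.
  - exact: measurable_powR_abs.
  - exact: measurable_funD.
  move=> x; have [v1'|v1'] := leP `|v x| 1.
    rewrite (le_trans (_ : _ <= 1)) ?lerDl ?powR_ge0//.
    by rewrite -[leRHS](pow1 p) ge0_ler_powR ?nnegrE// ltW.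
  by rewrite (le_trans (ler_powR (ltW v1') pq))// lerDr.
rewrite ge0_intD//.
rewrite int_cst Lpnorm_int// -EFinD lee_fin.
apply: (@le_trans _ _ 2); last by rewrite -[leLHS]powRr1// ler_powR// ler1n.
rewrite -[leRHS](_ : 1 + 1 = 2)// lerD2l.
rewrite -[leRHS](pow1 q) ge0_ler_powR ?nnegrE ?Lpnorm_ge0//.
by rewrite (le_trans ler01).
Qed.

End LpNorm.

(** * Bistochastic kernels *)

Section BistochasticKernel.
Context {d : measure_display} {S : measurableType d} {R : realType}.
Variables (mu : probability S R) (P : R.-pker S ~> S).
Hypothesis bi : bistochastic mu P.
Implicit Types (p q c : R) (u v : S -> R) (x : S).

Let pker_le1 x : (P x [set: S] <= 1)%E.
Proof. by rewrite prob_kernel. Qed.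

(** A separate name for [P x], to carry the subprobability structure that makes it a point of
    [giry]. *)
Let pk x : set S -> \bar R := P x.
HB.instance Definition _ x := Measure.on (pk x).
HB.instance Definition _ x := Measure_isSubProbability.Build _ _ _ (pk x) (pker_le1 x).
Let giryP x : giry S R := pk x.

Let measurable_giryP : measurable_fun [set: S] giryP.
Proof.
apply: measurable_giry_codensity => // B mB.
exact: (measurable_kernel P).
Qed.

Let muG : giry S R := mu.

(** Bistochasticity says that pushing [mu] through [P] gives back [mu]. With [P] seen as a
    measurable map into [giry], this push-forward is the monadic bind, whose integration formula
    extends the identity from sets to nonnegative functions. *)
Lemma int_kernel (f : S -> \bar R) : measurable_fun setT f -> (forall x, 0 <= f x)%E ->
  (\int[mu]_x \int[P x]_y f y = \int[mu]_x f x)%E.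
Proof.
move=> mf f0.
have E := giry_int_bind muG measurable_giryP mf f0.
(* [giry_bind muG measurable_giryP] is the measure [A |-> \int[mu]_x P x A], that is [mu]. *)
rewrite /giry_int in E; rewrite -[LHS]/(\int[muG]_x \int[giryP x]_y f y)%E -E.
apply: eq_measure_integral => A mA _.
rewrite -[A in LHS]setIT -integral_indic//.
have m1 : measurable_fun setT (EFin \o (\1_A : S -> R)).
  by apply/measurable_EFinP; exact: measurable_indic.
have E1 := giry_int_bind muG measurable_giryP m1 _.
transitivity (giry_int (giry_bind muG measurable_giryP) (EFin \o (\1_A : S -> R))) => //.
rewrite E1; last by move=> x; rewrite lee_fin.
apply: etrans (bi mA).
by apply: eq_integral => x _; rewrite /giry_int integral_indic// setIT.
Qed.


(** For a [mu]-null set [N], the function [P x N] of [x] has integral [mu N = 0], so it vanishes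
    almost everywhere. *)
Lemma ae_kernel (Q : S -> Prop) : {ae mu, forall x, Q x} ->
  {ae mu, forall x, {ae P x, forall y, Q y}}.
Proof.
move=> [N [mN muN QN]].
have : (\int[mu]_x `|P x N| = 0)%E.
  by under eq_integral do rewrite gee0_abs//; rewrite bi.
have mPN : measurable_fun setT (P ^~ N) by exact: (measurable_kernel P).
move/(ae_eq_integral_abs mu measurableT mPN).
by apply: filterS => x /(_ I) /= PN0; exists N.
Qed.

Lemma measurable_int_kernel (f : S -> R) : measurable_fun setT f -> (forall x, 0 <= f x) ->
  measurable_fun setT (fun x => \int[P x]_y (f y)%:E)%E.
Proof.
move=> mf f0; apply: measurable_fun_integral_kernel.
- exact: (measurable_kernel P).
- by move=> z; rewrite lee_fin.
- exact/measurable_EFinP.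
Qed.

(** No integrability is involved: the integrals of the positive and negative parts are measurable in
    [x], and [fine] is measurable also at the infinite values. *)
Lemma measurable_markov u : measurable_fun setT u -> measurable_fun setT (markov_op P u).
Proof.
move=> mu'.
have -> : markov_op P u = fun x =>
    fine (\int[P x]_y (Num.max (u y) 0)%:E - \int[P x]_y (Num.max (- u y) 0)%:E)%E.
  apply/funext => x; rewrite /markov_op /Rintegral integralE; congr (fine (_ - _)).
    by apply: eq_integral => y _; rewrite funeposE EFin_max.
  by apply: eq_integral => y _; rewrite funenegE EFin_max.
apply: (measurableT_comp (fine_measurable measurableT)).
apply: emeasurable_funB; apply: measurable_int_kernel.
- exact: measurable_maxr.
- by move=> x; rewrite le_max lexx orbT.
- by apply: measurable_maxr => //; exact: measurableT_comp.
- by move=> x; rewrite le_max lexx orbT.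
Qed.

(** By [int_kernel] the integral of [|u|] against [P x] has a finite [mu]-integral in [x], hence is
    finite almost everywhere. Outside this null set the usual rules for integrals apply to
    [markov_op]. *)
Lemma integrable_markov u : u \in Lfun mu 1%:E ->
  {ae mu, forall x, (P x).-integrable setT (EFin \o u)}.
Proof.
move=> Lu; have mu' := measurable_Lfun Lu.
have mau : measurable_fun setT (fun y => `|u y|) by exact: measurableT_comp.
have IK : mu.-integrable setT (fun x => \int[P x]_y `|u y|%:E)%E.
  apply/integrableP; split; first exact: measurable_int_kernel.
  under eq_integral do rewrite gee0_abs ?integral_ge0//.
  rewrite int_kernel//; last exact/measurable_EFinP.
  by case/LfunP_lty : Lu => _; rewrite Lnorm1.
apply: filterS (integrable_ae measurableT IK) => x /(_ I) fx.
apply/integrableP; split; first exact/measurable_EFinP.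
by rewrite ltey_eq fx.
Qed.

Lemma markov_ge0E f : f \in Lfun mu 1%:E -> (forall x, 0 <= f x) ->
  {ae mu, forall x, (markov_op P f x)%:E = (\int[P x]_y (f y)%:E)%E}.
Proof.
move=> Lf f0; apply: filterS (integrable_markov Lf) => x If.
by rewrite /markov_op /Rintegral fineK//; exact: integrable_fin_num.
Qed.

Lemma markov_lin c u v : u \in Lfun mu 1%:E -> v \in Lfun mu 1%:E ->
  {ae mu, forall x, markov_op P (fun y => c * u y + v y) x =
                    c * markov_op P u x + markov_op P v x}.
Proof.
move=> Lu Lv; apply: filterS2 (integrable_markov Lu) (integrable_markov Lv) => x Iu Iv.
rewrite /markov_op RintegralD//; last exact: (integrableZl measurableT c Iu).
by rewrite RintegralZl.
Qed.

Lemma markov_congr u v : measurable_fun setT u -> measurable_fun setT v ->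
  {ae mu, forall x, u x = v x} ->
  {ae mu, forall x, markov_op P u x = markov_op P v x}.
Proof.
move=> mu' mv uv; apply: filterS (ae_kernel uv) => x uvx.
congr fine; apply: ae_eq_integral => //.
- exact/measurable_EFinP.
- exact/measurable_EFinP.
by apply: filterS uvx => y uvy _; rewrite uvy.
Qed.

Lemma markov_abs_le u : u \in Lfun mu 1%:E ->
  {ae mu, forall x, `|markov_op P u x| <= markov_op P (fun y => `|u y|) x}.
Proof.
move=> Lu; apply: filterS (integrable_markov Lu) => x Iu.
exact: le_normr_Rintegral.
Qed.

Lemma markov_cst c x : markov_op P (fun=> c) x = c.
Proof.
by rewrite /markov_op /Rintegral integral_cst// prob_kernel mule1.
Qed.

Lemma Lfun1_abs u : u \in Lfun mu 1%:E -> (fun x => `|u x|) \in Lfun mu 1%:E.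
Proof.
move=> Lu; have [| |//] := @Lpnorm_le_ae _ _ _ mu 1 (fun x => `|u x|) u (lexx _) Lu.
  by apply: measurableT_comp => //; exact: measurable_Lfun Lu.
by apply: aeW => x; rewrite normr_id.
Qed.

Lemma Lfun1_markov u : u \in Lfun mu 1%:E -> markov_op P u \in Lfun mu 1%:E.
Proof.
move=> Lu; have La := Lfun1_abs Lu.
have mm := measurable_markov (measurable_Lfun Lu).
apply/LfunP_lty; split => //; rewrite Lnorm1.
apply: (@le_lt_trans _ _ (\int[mu]_x (markov_op P (fun y => `|u y|) x)%:E)%E).
  apply: ae_ge0_le_int.
  - exact: measurableT_comp.
  - exact: measurable_markov (measurable_Lfun La).
  - by [].
  - by move=> x; apply: Rintegral_ge0.
  - exact: markov_abs_le.
rewrite (ae_eq_integral (fun x => \int[P x]_y `|u y|%:E)%E)//.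
- rewrite int_kernel//; last exact/measurable_EFinP/(measurable_Lfun La).
  by case/LfunP_lty : Lu => _; rewrite Lnorm1.
- exact/measurable_EFinP/measurable_markov/(measurable_Lfun La).
- by apply: measurable_int_kernel => //; exact: measurable_Lfun La.
- by apply: filterS (markov_ge0E La (fun=> normr_ge0 _)) => x -> _.
Qed.

(** The nonnegative case is [int_kernel]. For a general [u] it is applied to [u + |u|] and to [|u|],
    and the second identity is cancelled from the first. *)
Lemma integral_markov u : u \in Lfun mu 1%:E ->
  \int[mu]_x markov_op P u x = \int[mu]_x u x.
Proof.
have ge0_case f : f \in Lfun mu 1%:E -> (forall x, 0 <= f x) ->
    \int[mu]_x markov_op P f x = \int[mu]_x f x.
  move=> Lf f0; congr fine; rewrite (ae_eq_integral (fun x => \int[P x]_y (f y)%:E)%E)//.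
  - rewrite int_kernel//; exact/measurable_EFinP/(measurable_Lfun Lf).
  - exact/measurable_EFinP/measurable_markov/(measurable_Lfun Lf).
  - by apply: measurable_int_kernel => //; exact: measurable_Lfun Lf.
  - by apply: filterS (markov_ge0E Lf f0) => x -> _.
move=> Lu; have La := Lfun1_abs Lu.
have [Ls _] := LpnormD (lexx 1) Lu La.
have s0 x : 0 <= u x + `|u x| by rewrite -lerBlDl sub0r -normrN ler_norm.
have h1 := ge0_case _ Ls s0; have h2 := ge0_case _ La (fun=> normr_ge0 _).
have I v : v \in Lfun mu 1%:E -> mu.-integrable setT (EFin \o v) by move/Lfun1_integrable.
rewrite RintegralD// in h1; [|exact: I..].
rewrite (_ : \int[mu]_x markov_op P _ x =
    \int[mu]_x (markov_op P u x + markov_op P (fun y => `|u y|) x)) in h1; last first.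
  congr fine; apply: ae_eq_integral => //.
  - exact/measurable_EFinP/measurable_markov/(measurable_Lfun Ls).
  - apply/measurable_EFinP; apply: measurable_funD; apply: measurable_markov;
      [exact: measurable_Lfun Lu|exact: measurable_Lfun La].
  have := markov_lin 1 Lu La.
  apply: filterS => x; under [fun y => 1 * _ + _]eq_fun do rewrite mul1r.
  by rewrite mul1r => -> _.
rewrite RintegralD// in h1; [|exact/I/Lfun1_markov..].
by rewrite h2 in h1; exact: addIr h1.
Qed.

End BistochasticKernel.

(** * The L^2 gap *)

Section Homogeneous.
Context {d : measure_display} {S : measurableType d} {R : realType}.
Variables (mu : probability S R).
Implicit Types (p q c : R) (u v : S -> R) (x : S).

Lemma Lpnorm2_sqr u : u \in Lfun mu 2%:E -> (Lpnorm mu 2 u ^+ 2)%:E = (\int[mu]_x (u x ^+ 2)%:E)%E.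
Proof.
move=> Lu; rewrite -powR_mulrn ?Lpnorm_ge0// -Lpnorm_int ?ler1n//.
by apply: eq_integral => x _; rewrite powR_mulrn// real_normK// num_real.
Qed.

Lemma Lpnorm4_pow u : u \in Lfun mu 4%:E -> (Lpnorm mu 4 u ^+ 4)%:E = (\int[mu]_x (u x ^+ 4)%:E)%E.
Proof.
move=> Lu; rewrite -powR_mulrn ?Lpnorm_ge0// -Lpnorm_int ?ler1n//.
apply: eq_integral => x _; rewrite powR_mulrn// (exprM _ 2 2) real_normK ?num_real//.
by rewrite -exprM.
Qed.

Lemma Lfun_le p q u : 1 <= p -> p <= q -> u \in Lfun mu q%:E -> u \in Lfun mu p%:E.
Proof. by move=> p1 pq Lu; have [C _ h] := Lpnorm_embed mu p1 pq; case: (h _ Lu). Qed.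

End Homogeneous.

Section SpectralGap.
Context {d : measure_display} {S : measurableType d} {R : realType}.
Variables (mu : probability S R) (P : R.-pker S ~> S).
Hypothesis bi : bistochastic mu P.
Implicit Types (p q c : R) (u v : S -> R) (x : S).

Lemma markov_scale c u : u \in Lfun mu 1%:E ->
  {ae mu, forall x, markov_op P (fun y => c * u y) x = c * markov_op P u x}.
Proof.
move=> Lu; have [L0 _] := @Lpnorm_cst _ _ _ mu 1 0 (lexx _).
apply: filterS (markov_lin bi c Lu L0) => x.
by under [fun y => _ + 0]eq_fun do rewrite addr0; rewrite markov_cst addr0.
Qed.

Lemma markov_affine a c u : u \in Lfun mu 1%:E ->
  {ae mu, forall x, markov_op P (fun y => c * u y + a) x = c * markov_op P u x + a}.
Proof.
move=> Lu; have [La _] := @Lpnorm_cst _ _ _ mu 1 a (lexx _).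
by apply: filterS (markov_lin bi c Lu La) => x ->; rewrite markov_cst.
Qed.

Let Lnorm_markov_le_opnorm u : maps_Lp mu P 2%:E 4%:E -> u \in Lfun mu 2%:E ->
  Lpnorm mu 2 u <= 1 -> ((Lpnorm mu 4 (markov_op P u))%:E <= opnorm mu P 2%:E 4%:E)%E.
Proof.
move=> P24 Lu u1; rewrite LpnormE; last exact: P24.
by apply: ereal_sup_ubound; exists u => //=; split => //; rewrite -LpnormE.
Qed.

Lemma opnorm_ge0 : maps_Lp mu P 2%:E 4%:E -> (0 <= opnorm mu P 2%:E 4%:E)%E.
Proof.
move=> P24; have [L0 h0] := Lpnorm_cst mu 0 (ler1n R 2).
apply: le_trans (Lnorm_markov_le_opnorm P24 L0 _); first by rewrite lee_fin Lpnorm_ge0.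
by rewrite (le_trans h0)// normr0.
Qed.

(** Finiteness matters: [fine] would turn an infinite [opnorm] into 0. *)
Lemma opnorm_bound : maps_Lp mu P 2%:E 4%:E -> (opnorm mu P 2%:E 4%:E < +oo)%E ->
  forall u, u \in Lfun mu 2%:E -> markov_op P u \in Lfun mu 4%:E /\
    Lpnorm mu 4 (markov_op P u) <= fine (opnorm mu P 2%:E 4%:E) * Lpnorm mu 2 u.
Proof.
move=> P24 Pfin; apply: bounded_of_ball; rewrite ?ler1n//.
- exact/fine_ge0/opnorm_ge0.
- by move=> c u Lu; apply: markov_scale; apply: Lfun_le Lu => //; rewrite ler1n.
- by move=> u /measurable_Lfun; exact: measurable_markov.
move=> u Lu u1; split; first exact: P24.
rewrite -lee_fin [leRHS]fineK; first exact: Lnorm_markov_le_opnorm.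
by rewrite ge0_fin_numE// opnorm_ge0.
Qed.

(** Write [M = N^4], [e = s^2] and [a] for the squared L^2 norm of [Pu]. The sum of the two L^4
    bounds, with the fourth power term bounded below by [a^2], reduces to
    [a^2 + 6 e a + e^2 <= 4 M e^2]. The left side increases with [a], and at [a = M e / 2] it
    exceeds the right side by the square [(1 - M/2)^2 e^2]. *)
Lemma spectral_gap N u : 0 <= N ->
  (forall v, v \in Lfun mu 2%:E -> markov_op P v \in Lfun mu 4%:E /\
    Lpnorm mu 4 (markov_op P v) <= N * Lpnorm mu 2 v) ->
  u \in Lfun mu 2%:E -> \int[mu]_x u x = 0 ->
  Lpnorm mu 2 (markov_op P u) ^+ 2 <= N ^+ 4 / 2 * Lpnorm mu 2 u ^+ 2.
Proof.
move=> N0 hN Lu u0; set s := Lpnorm mu 2 u; set g := markov_op P u.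
have s0 : 0 <= s by exact: Lpnorm_ge0.
have L1u : u \in Lfun mu 1%:E by apply: Lfun_le Lu => //; rewrite ler1n.
have mu' := measurable_Lfun Lu.
have [Lg4 _] := hN u Lu.
have Lg2 : g \in Lfun mu 2%:E by apply: Lfun_le Lg4; rewrite ?ler1n ?ler_nat.
have mg := measurable_Lfun Lg4.
have Iu : mu.-integrable setT (EFin \o u) by exact/Lfun1_integrable.
have Iu2 := Lfun2_integrable_sqr Lu.
(* [e] is a sign, so both test functions are treated at once. As [u] has mean 0, the squared norm of
   [e * u + s] is [2 * s ^+ 2]; its square gives the factor 4. *)
have quad e : e ^+ 2 = 1 -> (\int[mu]_x ((e * g x + s) ^+ 4)%:E <= (4 * N ^+ 4 * s ^+ 4)%:E)%E.
  move=> e2.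
  have [Leu _] := LpnormZ_le e (ler1n _ 2) Lu.
  have [Ls _] := @Lpnorm_cst _ _ _ mu 2 s (ler1n _ _).
  have [Lw _] := LpnormD (ler1n _ 2) Leu Ls.
  have [LPw Pw] := hN _ Lw.
  have w2 : Lpnorm mu 2 (fun x => e * u x + s) ^+ 2 = 2 * s ^+ 2.
    have Ieu : mu.-integrable setT (EFin \o (fun x => 2 * e * s * u x)).
      exact: (integrableZl measurableT (2 * e * s) Iu).
    have Is : mu.-integrable setT (EFin \o (fun=> s ^+ 2 : R)).
      exact: finite_measure_integrable_cst.
    apply: EFin_inj; rewrite Lpnorm2_sqr//.
    under eq_integral => x _.
      rewrite (_ : (e * u x + s) ^+ 2 = u x ^+ 2 + (2 * e * s * u x + s ^+ 2)); last first.
        by rewrite sqrrD exprMn e2; ring.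
      rewrite EFinD EFinD.
    over.
    rewrite integralD//; last exact: integrableD.
    rewrite integralD// -Lpnorm2_sqr// int_cst.
    have -> : (\int[mu]_x (2 * e * s * u x)%:E = 0)%E.
      under eq_integral do rewrite EFinM; rewrite integralZl//.
      by rewrite -[X in (_ * X)%E]fineK ?integrable_fin_num//= -/(Rintegral _ _ _) u0 mule0.
    by rewrite add0e -EFinD -/s; congr EFin; ring.
  apply: (@le_trans _ _ (Lpnorm mu 4 (markov_op P (fun x => e * u x + s)) ^+ 4)%:E).
    pose wP := markov_op P (fun x => e * u x + s).
    rewrite Lpnorm4_pow// (ae_eq_integral (fun x => (wP x ^+ 4)%:E))//.
    - by apply/measurable_EFinP/measurable_funX/measurable_funD => //; exact: measurable_funM.
    - by apply/measurable_EFinP/measurable_funX; exact: measurable_Lfun LPw.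
    - by apply: filterS (markov_affine s e L1u) => x; rewrite -/wP => -> _.
  rewrite lee_fin (@le_trans _ _ ((N * Lpnorm mu 2 (fun x => e * u x + s)) ^+ 4))//.
    by rewrite lerXn2r ?nnegrE ?mulr_ge0 ?Lpnorm_ge0.
  rewrite exprMn (exprM (Lpnorm _ _ _) 2 2) w2 exprMn -exprM.
  by rewrite le_eqVlt; apply/orP; left; apply/eqP; ring.
set a := Lpnorm mu 2 g ^+ 2.
have mg2 : measurable_fun setT (fun x => g x ^+ 2) by exact: measurable_funX.
have mg4 : measurable_fun setT (fun x => g x ^+ 4) by exact: measurable_funX.
have sum4 : (\int[mu]_x (2 * g x ^+ 4 + (12 * s ^+ 2 * g x ^+ 2 + 2 * s ^+ 4))%:E <=
    (8 * N ^+ 4 * s ^+ 4)%:E)%E.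
  under eq_integral => x _.
    rewrite (_ : 2 * _ + _ = (1 * g x + s) ^+ 4 + (-1 * g x + s) ^+ 4); last by ring.
    over.
  rewrite ge0_intD//.
  - rewrite (_ : 8 * N ^+ 4 * s ^+ 4 = 4 * N ^+ 4 * s ^+ 4 + 4 * N ^+ 4 * s ^+ 4); last by ring.
    by rewrite EFinD; apply: leeD; apply: quad; rewrite ?expr1n// sqrrN expr1n.
  - by apply/measurable_funX/measurable_funD => //; exact: measurable_funM.
  - by apply/measurable_funX/measurable_funD => //; exact: measurable_funM.
  - by move=> x; rewrite exprn_even_ge0.
  - by move=> x; rewrite exprn_even_ge0.
have n2 (y : R) : 0 <= y ^+ 2 by exact: sqr_ge0.
have n4 (y : R) : 0 <= y ^+ 4 by exact: exprn_even_ge0.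
have a0 : 0 <= a by rewrite sqr_ge0.
(* Cauchy-Schwarz against the constant 1, read off from the integral of [(g^2 - a)^2 >= 0]. *)
have g4a : a ^+ 2 <= Lpnorm mu 4 g ^+ 4.
  have : (\int[mu]_x (2 * a * g x ^+ 2)%:E <= \int[mu]_x (g x ^+ 4 + a ^+ 2)%:E)%E.
    apply: ge0_le_int.
    - exact: measurable_funM.
    - exact: measurable_funD.
    - by move=> x; rewrite mulr_ge0 ?sqr_ge0// mulr_ge0.
    - move=> x; rewrite -subr_ge0 (_ : _ - _ = (g x ^+ 2 - a) ^+ 2); last by ring.
      exact: sqr_ge0.
  rewrite ge0_intZ ?(mulr_ge0 _ a0)// ge0_intD//.
  by rewrite int_cst -Lpnorm2_sqr// -Lpnorm4_pow// -EFinM -EFinD lee_fin -/a; lra.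
move: sum4; rewrite ge0_intD//; last 4 first.
- exact: measurable_funM.
- by apply: measurable_funD => //; exact: measurable_funM.
- by move=> x; apply: mulr_ge0.
- by move=> x; apply: addr_ge0; apply: mulr_ge0 => //; apply: mulr_ge0.
rewrite ge0_intD//; last 3 first.
- exact: measurable_funM.
- by move=> x; apply: mulr_ge0 => //; apply: mulr_ge0.
- by move=> x; apply: mulr_ge0.
rewrite ge0_intZ// ge0_intZ//; last by apply: mulr_ge0.
rewrite int_cst -Lpnorm2_sqr// -Lpnorm4_pow// -!EFinM -!EFinD lee_fin -/a.
set M := N ^+ 4; set G := Lpnorm mu 4 g ^+ 4 in g4a *.
rewrite (_ : s ^+ 4 = s ^+ 2 * s ^+ 2); last by rewrite -exprD.
have M0 : 0 <= M by rewrite exprn_ge0.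
have : 0 <= s ^+ 2 by rewrite sqr_ge0.
move: (s ^+ 2) => e e0 h.
(* [t] is the supposed excess of [a] over [M / 2 * e]; in terms of it the quadratic inequality fails
   by [(1 - M/2)^2 e^2 + 6 e t + t (t + M e)], which is positive. *)
rewrite leNgt; apply/negP; rewrite -subr_gt0; set t := a - _ => t0.
have ht : 0 < t * (t + M * e) by rewrite mulr_gt0// ltr_pwDl// mulr_ge0.
have het : 0 <= 6 * e * t by rewrite !mulr_ge0// ltW.
have hM : 0 <= (1 - M / 2) ^+ 2 * e ^+ 2 by rewrite mulr_ge0 ?sqr_ge0.
have aE : a = t + M / 2 * e by rewrite /t subrK.
have : 0 < (1 - M / 2) ^+ 2 * e ^+ 2 + 6 * e * t + t * (t + M * e) by rewrite ltr_wpDl// addr_ge0.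
rewrite (_ : _ + t * _ = (2 * G + (12 * e * a + 2 * (e * e)) - 8 * M * (e * e)) / 2 - (G - a ^+ 2)).
  lra.
by rewrite aE; field.
Qed.

End SpectralGap.

(** * Smoothing and decay in L^r *)

(* The first term dominates for [t <= y], the second one for [y <= t]. *)
Lemma powR_split {R : realType} (a b t y : R) : 1 <= a -> b <= 1 -> 0 < t -> 0 <= y ->
  y <= t `^ (1 - a) * y `^ a + t `^ (1 - b) * y `^ b.
Proof.
move=> a1 b1 t0; rewrite le_eqVlt => /predU1P[<-|y0].
  by rewrite addr_ge0// mulr_ge0 ?powR_ge0.
have yE c : y = y `^ (1 - c) * y `^ c.
  by rewrite -powRD ?subrK ?powRr1 ?ltW// gt_eqF// implybT.
have [yt|ty] := leP y t.
  rewrite (le_trans (_ : _ <= t `^ (1 - b) * y `^ b)) ?lerDr ?mulr_ge0 ?powR_ge0//.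
  rewrite [leLHS](yE b) ler_wpM2r ?powR_ge0// ge0_ler_powR ?nnegrE ?subr_ge0// ltW//.
rewrite (le_trans (_ : _ <= t `^ (1 - a) * y `^ a)) ?lerDl ?mulr_ge0 ?powR_ge0//.
rewrite [leLHS](yE a) ler_wpM2r ?powR_ge0// -opprB !powRN lef_pV2 ?posrE ?powR_gt0//.
by rewrite ge0_ler_powR ?nnegrE ?subr_ge0// ltW.
Qed.

Section Smoothing.
Context {d : measure_display} {S : measurableType d} {R : realType}.
Variables (mu : probability S R) (P : R.-pker S ~> S).
Hypothesis bi : bistochastic mu P.
Implicit Types (a b p q r c : R) (u v : S -> R) (x : S).

(** The quantifier on [t] sits inside the almost everywhere statement: integrability of three
    functions against [P x] settles all levels at once, so [t] may later depend on [x]. *)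
Lemma markov_split a b u : 1 <= a -> b <= 1 -> u \in Lfun mu 1%:E ->
  (fun x => `|u x| `^ a) \in Lfun mu 1%:E -> (fun x => `|u x| `^ b) \in Lfun mu 1%:E ->
  {ae mu, forall x, forall t, 0 < t -> `|markov_op P u x| <=
    t `^ (1 - a) * markov_op P (fun y => `|u y| `^ a) x +
    t `^ (1 - b) * markov_op P (fun y => `|u y| `^ b) x}.
Proof.
move=> a1 b1 Lu La Lb.
have Ia := integrable_markov bi La; have Ib := integrable_markov bi Lb.
apply: filterS3 (integrable_markov bi Lu) Ia Ib => x Iu {}Ia {}Ib t t0.
apply: (le_trans (le_normr_Rintegral _ Iu)) => //.
have Iau : (P x).-integrable setT (EFin \o (fun y => `|u y|)) by exact: integrable_abse Iu.
have Iat := integrableZl measurableT (t `^ (1 - a)) Ia.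
have Ibt := integrableZl measurableT (t `^ (1 - b)) Ib.
rewrite /markov_op -RintegralZl// -RintegralZl// -RintegralD//.
apply: le_Rintegral => //; first exact: (integrableD measurableT Iat Ibt).
by move=> y _; exact: powR_split.
Qed.

Lemma markov_powR_ge0 a u x : 0 <= markov_op P (fun y => `|u y| `^ a) x.
Proof. by apply: Rintegral_ge0 => y _; exact: powR_ge0. Qed.

Lemma Lpnorm_le_powR p u c : 1 <= p -> measurable_fun setT u -> 0 <= c ->
  (\int[mu]_x (`|u x| `^ p)%:E <= c%:E)%E ->
  u \in Lfun mu p%:E /\ Lpnorm mu p u <= c `^ p^-1.
Proof.
move=> p1 mu' c0 h; apply: Lpnorm_le => //; first exact: powR_ge0.
by rewrite -powRrM mulVf ?powRr1// gt_eqF// (lt_le_trans ltr01).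
Qed.

Lemma Lfun_powR r s u : 0 < s -> s <= r -> 1 <= r -> u \in Lfun mu r%:E -> Lpnorm mu r u <= 1 ->
  (fun x => `|u x| `^ s) \in Lfun mu (r / s)%:E /\ Lpnorm mu (r / s) (fun x => `|u x| `^ s) <= 1.
Proof.
move=> s0 sr r1 Lu u1; have rs1 : 1 <= r / s by rewrite ler_pdivlMr// mul1r.
apply: Lpnorm_le => //; first exact/measurable_powR_abs/(measurable_Lfun Lu).
under eq_integral do rewrite ger0_norm ?powR_ge0// -powRrM mulrCA mulfV ?gt_eqF// mulr1.
have e1 : 1 `^ r = 1 :> R by rewrite powR1.
rewrite Lpnorm_int// powR1 lee_fin -[leRHS]e1.
by rewrite ge0_ler_powR ?nnegrE ?Lpnorm_ge0// (le_trans ler01).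
Qed.

Definition bounded_iter p q k := exists2 C : R, 0 <= C & forall u, u \in Lfun mu p%:E ->
  iter k (markov_op P) u \in Lfun mu q%:E /\
  Lpnorm mu q (iter k (markov_op P) u) <= C * Lpnorm mu p u.

Lemma bounded_iter_comp p q r k m :
  bounded_iter p q k -> bounded_iter q r m -> bounded_iter p r (m + k).
Proof.
move=> [C C0 hC] [D D0 hD]; exists (D * C); first exact: mulr_ge0.
move=> u Lu; have [Lk hk] := hC u Lu; have [Lm hm] := hD _ Lk.
by rewrite iterD; split => //; rewrite (le_trans hm)// -mulrA ler_wpM2l.
Qed.

Lemma bounded_iter0 p q : 1 <= q -> q <= p -> bounded_iter p q 0.
Proof. by move=> q1 qp; have [C C0 h] := Lpnorm_embed mu q1 qp; exists C. Qed.

Lemma bounded_iter1 p q C : 1 <= p -> 1 <= q -> 0 <= C ->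
  (forall u, u \in Lfun mu p%:E -> Lpnorm mu p u <= 1 ->
     (\int[mu]_x (`|markov_op P u x| `^ q)%:E <= C%:E)%E) ->
  bounded_iter p q 1.
Proof.
move=> p1 q1 C0 ball; exists (C `^ q^-1); first exact: powR_ge0.
apply: (@bounded_of_ball _ _ _ mu p q (markov_op P)) => //; first exact: powR_ge0.
- by move=> c u Lu; apply: markov_scale; [exact: bi|exact: Lfun_le Lu].
- by move=> u /measurable_Lfun; exact: measurable_markov.
move=> u Lu u1; apply: Lpnorm_le_powR => //; last exact: ball.
exact/measurable_markov/(measurable_Lfun Lu).
Qed.

Variable N : R.
Hypothesis N0 : 0 <= N.
Hypothesis P24 : forall v, v \in Lfun mu 2%:E -> markov_op P v \in Lfun mu 4%:E /\
    Lpnorm mu 4 (markov_op P v) <= N * Lpnorm mu 2 v.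

(** The split is used with [a = r/2] and [b = 0], where the second term is just the level [t]
    because [P] fixes 1. As [g = |u|^(r/2)] lies in the unit ball of L^2, [W = 1 + P g] is in L^4,
    and the level [W^(2/r)] bounds both terms by [W^(2/r)], whose power [2 r] is [W^4]. The summand
    1 keeps the level positive. *)
Lemma smoothing_ge2 r : 2 <= r -> bounded_iter r (2 * r) 1.
Proof.
move=> r2; have r1 : 1 <= r by rewrite (le_trans _ r2)// ler1n.
have r0 : 0 < r by rewrite (lt_le_trans ltr01).
apply: (@bounded_iter1 _ _ (2 `^ (2 * r) * (1 + N) ^+ 4)) => //.
- by rewrite (le_trans r1)// ler_peMl ?ler1n// ltW.
- by rewrite mulr_ge0 ?powR_ge0 ?exprn_ge0 ?addr_ge0.
move=> u Lu u1; have mu' := measurable_Lfun Lu.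
have [] : (fun x => `|u x| `^ (r / 2)) \in Lfun mu (r / (r / 2))%:E /\
    Lpnorm mu (r / (r / 2)) (fun x => `|u x| `^ (r / 2)) <= 1.
  by apply: Lfun_powR => //; lra.
have -> : r / (r / 2) = 2 by field; rewrite gt_eqF.
set g := fun x => _ => Lg g1; set w := markov_op P g.
have [Lw hw] := P24 Lg; rewrite -/w in Lw hw.
have w0 x : 0 <= w x by exact: markov_powR_ge0.
have [L1 h1] := @Lpnorm_cst _ _ _ mu 4 1 (ler1n _ _).
have [LW hW] := LpnormD (ler1n _ 4) L1 Lw; set W := fun x => _ in LW hW.
have mW := measurable_Lfun LW.
have W1 x : 1 <= W x by rewrite /W lerDl.
have hW' : Lpnorm mu 4 W <= 1 + N.
  rewrite (le_trans hW)// lerD//; first by rewrite (le_trans h1)// normr1.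
  by rewrite (le_trans hw)// -[leRHS]mulr1 ler_wpM2l.
have -> : (2 `^ (2 * r) * (1 + N) ^+ 4)%:E = ((2 `^ (2 * r))%:E * ((1 + N) ^+ 4)%:E)%E by [].
apply: (@le_trans _ _ (\int[mu]_x (2 `^ (2 * r) * W x ^+ 4)%:E)%E); last first.
  rewrite ge0_intZ ?powR_ge0//.
  - apply: lee_wpmul2l; first by rewrite lee_fin powR_ge0.
    by rewrite -Lpnorm4_pow// lee_fin lerXn2r ?nnegrE ?Lpnorm_ge0 ?addr_ge0.
  - exact: measurable_funX.
  - by move=> x; rewrite exprn_even_ge0.
have L1u : u \in Lfun mu 1%:E by exact: Lfun_le Lu.
have L1g : g \in Lfun mu 1%:E by apply: Lfun_le Lg; rewrite ?ler1n.
have L0 : (fun x => `|u x| `^ 0) \in Lfun mu 1%:E.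
  by under eq_fun do rewrite powRr0; exact: (proj1 (Lpnorm_cst _ _ (lexx _))).
have r21 : 1 <= r / 2 by lra.
apply: ae_ge0_le_int.
- exact/measurable_powR_abs/measurable_markov.
- by apply: measurable_funM => //; exact: measurable_funX.
- by move=> x; rewrite powR_ge0.
- by move=> x; rewrite mulr_ge0 ?powR_ge0 ?exprn_even_ge0.
apply: filterS (markov_split r21 ler01 L1u L1g L0) => x.
have W0 : 0 < W x by rewrite (lt_le_trans ltr01).
move=> /(_ (W x `^ (2 / r)) (powR_gt0 _ W0)).
rewrite (_ : (fun y => `|u y| `^ 0) = fun=> 1); last by apply/funext => y; rewrite powRr0.
rewrite markov_cst mulr1 subr0 powRr1 ?powR_ge0// -powRrM.
have -> : 2 / r * (1 - r / 2) = 2 / r - 1 by field; rewrite gt_eqF.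
rewrite -/w => hx.
have {}hx : `|markov_op P u x| <= 2 * W x `^ (2 / r).
  apply: (le_trans hx).
  have -> : 2 * W x `^ (2 / r) = W x `^ (2 / r - 1) * W x + W x `^ (2 / r).
    rewrite -[X in _ * X + _]powRr1 ?ltW// -powRD ?subrK; last first.
      by rewrite (gt_eqF W0) implybT.
    by rewrite mulrDl mul1r.
  by rewrite lerD2r ler_wpM2l ?powR_ge0// /W lerDr.
have -> : 2 `^ (2 * r) * W x ^+ 4 = (2 * W x `^ (2 / r)) `^ (2 * r).
  rewrite powRM ?powR_ge0// -powRrM (_ : 2 / r * (2 * r) = 4%:R); last by field; rewrite gt_eqF.
  by rewrite powR_mulrn// ltW.
by rewrite ge0_ler_powR ?nnegrE ?mulr_ge0 ?powR_ge0// ltW.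
Qed.

(** The split is used with [a = r] and [b = r/2]: [|u|^r] is in L^1, where [P] preserves the
    integral, and [|u|^(r/2)] is in L^2, where [P24] applies. The target exponent is the
    interpolated one: if [1/r = 1 - th/2], then [1/q = 1 - 3 th/4]. *)
Lemma smoothing_lt2 r : 1 < r -> r < 2 -> bounded_iter r (2 * r / (3 - r)) 1.
Proof.
move=> r1 r2; have r0 : 0 < r by rewrite (lt_trans ltr01).
have r3 : 0 < 3 - r by lra.
set q := 2 * r / (3 - r).
have q1 : 1 <= q by rewrite /q ler_pdivlMr//; lra.
have q0 : 0 < q by rewrite (lt_le_trans ltr01).
apply: (@bounded_iter1 _ _ (2 `^ q * (2 + N ^+ 4))) => //; first exact: ltW.
  by rewrite mulr_ge0 ?powR_ge0 ?addr_ge0 ?exprn_ge0.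
move=> u Lu u1; have mu' := measurable_Lfun Lu.
have [] : (fun x => `|u x| `^ (r / 2)) \in Lfun mu (r / (r / 2))%:E /\
    Lpnorm mu (r / (r / 2)) (fun x => `|u x| `^ (r / 2)) <= 1.
  by apply: Lfun_powR => //; lra.
have -> : r / (r / 2) = 2 by field; rewrite gt_eqF.
set g := fun x => _ => Lg g1; set G := markov_op P g.
have [LG hG] := P24 Lg; rewrite -/G in LG hG.
have [] : (fun x => `|u x| `^ r) \in Lfun mu (r / r)%:E /\
    Lpnorm mu (r / r) (fun x => `|u x| `^ r) <= 1.
  by apply: Lfun_powR => //; exact: ltW.
rewrite mulfV ?gt_eqF//; set f := fun x => _ => Lf f1; set F := markov_op P f.
have G0 x : 0 <= G x by exact: markov_powR_ge0.
have F0 x : 0 <= F x by exact: markov_powR_ge0.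
have LF : F \in Lfun mu 1%:E by exact: Lfun1_markov.
(* [W] dominates both [F] and [G ^+ 4], so that the level [W `^ (3 / (2 * r))]
   makes both terms of [markov_split] at most [W `^ q^-1]. *)
pose W x := 1 + (F x + G x ^+ 4).
have mF := measurable_Lfun LF; have mG := measurable_Lfun LG.
have mG4 : measurable_fun setT (fun x => G x ^+ 4) by exact: measurable_funX.
have G40 x : 0 <= G x ^+ 4 by exact: exprn_even_ge0.
have FG0 x : 0 <= F x + G x ^+ 4 by rewrite addr_ge0.
have mW : measurable_fun setT W by apply: measurable_funD => //; exact: measurable_funD.
have W1 x : 1 <= W x by rewrite /W lerDl.
(* The constant contributes 1, [F] at most 1, and [G ^+ 4] at most [N ^+ 4]. *)
have intW : (\int[mu]_x (W x)%:E <= (2 + N ^+ 4)%:E)%E.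
  rewrite ge0_intD//; last exact: measurable_funD.
  rewrite ge0_intD// int_cst -Lpnorm4_pow//.
  have -> : (\int[mu]_x (F x)%:E = (Lpnorm mu 1 f)%:E)%E.
    rewrite (ae_eq_integral (fun x => \int[P x]_y (f y)%:E)%E)//.
    - rewrite int_kernel//.
      + rewrite LpnormE// Lnorm1; apply: eq_integral => x _.
        by rewrite /= ger0_norm ?powR_ge0.
      + exact/measurable_EFinP/(measurable_Lfun Lf).
      + by move=> x; rewrite lee_fin powR_ge0.
    - exact: ((measurable_EFinP _ _).2 mF).
    - by apply: measurable_int_kernel => //; [exact: measurable_Lfun Lf|move=> x; exact: powR_ge0].
    - by apply: filterS (markov_ge0E bi Lf (fun=> powR_ge0 _ _)) => x -> _.
  rewrite -!EFinD lee_fin (_ : 2 = 1 + 1)// -addrA lerD2l lerD//.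
  rewrite lerXn2r ?nnegrE ?Lpnorm_ge0// (le_trans hG)//.
  by rewrite -[leRHS]mulr1 ler_wpM2l.
rewrite EFinM; apply: (@le_trans _ _ (\int[mu]_x (2 `^ q * W x)%:E)%E); last first.
  rewrite ge0_intZ ?powR_ge0//; last by move=> x; rewrite (le_trans ler01).
  by apply: lee_wpmul2l => //; rewrite lee_fin powR_ge0.
have L1u : u \in Lfun mu 1%:E by apply: Lfun_le Lu => //; exact: ltW.
have L1g : g \in Lfun mu 1%:E by apply: Lfun_le Lg; rewrite ?ler1n.
apply: ae_ge0_le_int.
- exact/measurable_powR_abs/measurable_markov.
- exact: measurable_funM.
- by move=> x; rewrite powR_ge0.
- by move=> x; rewrite mulr_ge0 ?powR_ge0// (le_trans ler01).
have r21 : r / 2 <= 1 by lra.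
apply: filterS (markov_split (ltW r1) r21 L1u Lf L1g) => x.
have W0 : 0 < W x by rewrite (lt_le_trans ltr01).
move=> /(_ (W x `^ (3 / (2 * r))) (powR_gt0 _ W0)); rewrite -!powRrM -/F -/G => hx.
have GW : G x <= W x `^ 4^-1.
  rewrite -[leLHS](_ : (G x ^+ 4) `^ 4^-1 = _); last first.
    by rewrite -powR_mulrn// -powRrM mulfV ?powRr1.
  rewrite ge0_ler_powR ?nnegrE ?invr_ge0 ?(ltW W0)//.
  by rewrite /W addrA lerDr addr_ge0.
have FW : F x <= W x `^ 1.
  by rewrite powRr1 ?(ltW W0)// /W addrCA lerDl addr_ge0.
have Wadd c e : W x `^ c * W x `^ e = W x `^ (c + e).
  by rewrite powRD// (gt_eqF W0) implybT.
have {}hx : `|markov_op P u x| <= 2 * W x `^ q^-1.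
  apply: (le_trans hx); rewrite [leRHS]mulrDl mul1r; apply: lerD.
    apply: (le_trans (ler_wpM2l (powR_ge0 _ _) FW)).
    rewrite Wadd (_ : _ + 1 = q^-1)//.
    by rewrite /q; field; rewrite !gt_eqF.
  apply: (le_trans (ler_wpM2l (powR_ge0 _ _) GW)).
  rewrite Wadd (_ : _ + 4^-1 = q^-1)//.
  by rewrite /q; field; rewrite !gt_eqF.
have -> : 2 `^ q * W x = (2 * W x `^ q^-1) `^ q.
  by rewrite powRM ?powR_ge0// -powRrM mulVf ?gt_eqF// powRr1// ltW.
by apply: (ge0_ler_powR (ltW q0)); rewrite ?nnegrE ?mulr_ge0 ?powR_ge0.
Qed.


(** One application of [P] raises an exponent [s < 2] by [s (s - 1) / (3 - s)], which is at least
    [(s - 1) / 2]. Since exponents never drop below [r], each step gains at least [(r - 1) / 2], and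
    finitely many steps reach 2. *)
Lemma bounded_to_L2 r : 1 < r -> exists k, bounded_iter r 2 k.
Proof.
move=> r1; have e0 : 0 < (r - 1) / 2 by rewrite divr_gt0// subr_gt0.
suff step n s : r <= s -> 2 <= s + n%:R * ((r - 1) / 2) -> exists k, bounded_iter s 2 k.
  have := archi_boundP (ltW (divr_gt0 (ltr0n R 2) e0)).
  set n := Num.bound _; rewrite ltr_pdivrMr// => /ltW h.
  by apply: (step n) => //; rewrite (le_trans h)// lerDr (le_trans ler01)// ltW.
elim: n s => [|n ih] s rs.
  by rewrite mul0r addr0 => s2; exists 0%N; apply: bounded_iter0; rewrite ?ler1n.
have [s2 _|s2 h] := leP 2 s; first by exists 0%N; apply: bounded_iter0; rewrite ?ler1n.
have s1 : 1 < s by rewrite (lt_le_trans r1).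
have grow : s + (r - 1) / 2 <= 2 * s / (3 - s).
  rewrite ler_pdivlMr; last by lra.
  have ss : 0 <= (s - 1) * (s - 1) by rewrite -expr2 sqr_ge0.
  nra.
have [||k hk] := ih (2 * s / (3 - s)).
- by rewrite (le_trans rs)// (le_trans _ grow)// lerDl ltW.
- by rewrite (le_trans h)// -natr1 mulrDl mul1r addrCA [leRHS]addrC lerD2l.
by exists (k + 1)%N; exact: bounded_iter_comp (smoothing_lt2 s1 s2) hk.
Qed.

(** Each step doubles the exponent; only the linear growth [2 + 2 n] is retained, which is enough to
    pass the Archimedean bound of [r]. *)
Lemma bounded_from_L2 r : 1 <= r -> exists k, bounded_iter 2 r k.
Proof.
move=> r1; suff [k hk] : exists k, bounded_iter 2 (2 + 2 * (Num.bound r)%:R) k.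
  exists k; rewrite -[k]add0n; apply: bounded_iter_comp hk _; apply: bounded_iter0 => //.
  have /ltW h := archi_boundP (le_trans ler01 r1).
  by rewrite (le_trans h)// ler_wpDl// ler_peMl// ler1n.
elim: (Num.bound r) => [|n [k hk]].
  by exists 0%N; rewrite mulr0 addr0; apply: bounded_iter0; rewrite ?ler1n.
exists (0 + (1 + k))%N; apply: (bounded_iter_comp (bounded_iter_comp hk (smoothing_ge2 _))).
  by rewrite lerDl mulr_ge0.
have n0 : 0 <= n%:R :> R by [].
apply: bounded_iter0; rewrite -natr1; lra.
Qed.

(** One smoothing step followed by the embedding back into L^r. The resulting constant may exceed 1;
    it is absorbed in the constant of [geometric_decay]. *)
Lemma bounded_markov r : 1 < r -> bounded_iter r r 1.
Proof.
move=> r1; rewrite -[1%N]add0n; have [r2|r2] := leP 2 r.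
  apply: (bounded_iter_comp (smoothing_ge2 r2)); apply: bounded_iter0; [exact: ltW|lra].
apply: (bounded_iter_comp (smoothing_lt2 r1 r2)); apply: bounded_iter0; first exact: ltW.
by rewrite ler_pdivlMr; [nra|lra].
Qed.

Hypothesis N2 : N ^+ 4 < 2.

Lemma iter_mean0 k u : u \in Lfun mu 1%:E ->
  iter k (markov_op P) u \in Lfun mu 1%:E /\
  \int[mu]_x iter k (markov_op P) u x = \int[mu]_x u x.
Proof.
move=> Lu; elim: k => [//|k [Lk hk]]; split; first exact: Lfun1_markov.
by rewrite iterS integral_markov.
Qed.

(** For large [n] the power is factored as [P^m P^j P^k]: [P^k] takes L^r to L^2, [P^j] contracts
    there, and [P^m] returns to L^r. The rate is the L^2 one for every [r]; only [C] depends on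
    [r]. *)
Lemma geometric_decay : exists2 rho : R, 0 < rho < 1 & forall r, 1 < r ->
  exists2 C : R, 0 <= C & forall n u, u \in Lfun mu r%:E -> \int[mu]_x u x = 0 ->
    iter n (markov_op P) u \in Lfun mu r%:E /\
    Lpnorm mu r (iter n (markov_op P) u) <= C * rho ^+ n * Lpnorm mu r u.
Proof.
(* [rho ^+ 2] is the midpoint of [N ^+ 4 / 2] and 1: below 1, above the contraction factor, and
   positive even for [N = 0], which allows dividing by powers of [rho]. *)
pose rho : R := Num.sqrt ((N ^+ 4 / 2 + 1) / 2).
have M0 : 0 <= N ^+ 4 by exact: exprn_ge0.
have M2 : 0 < 2 - N ^+ 4 by rewrite subr_gt0.
have rho2 : rho ^+ 2 = (N ^+ 4 / 2 + 1) / 2 by rewrite sqr_sqrtr//; lra.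
have rho0 : 0 < rho by rewrite sqrtr_gt0; lra.
have rho1 : rho < 1.
  by rewrite -(expr_lt1 (isT : (0 < 2)%N) (ltW rho0)) rho2; lra.
exists rho; first by rewrite rho0.
have gap n u : u \in Lfun mu 2%:E -> \int[mu]_x u x = 0 ->
    iter n (markov_op P) u \in Lfun mu 2%:E /\
    Lpnorm mu 2 (iter n (markov_op P) u) <= rho ^+ n * Lpnorm mu 2 u.
  move=> Lu u0; have L1u : u \in Lfun mu 1%:E by apply: Lfun_le Lu; rewrite ?ler1n.
  elim: n => [|n [Ln hn]]; first by rewrite expr0 mul1r.
  have [_ mn] := iter_mean0 n L1u; rewrite u0 in mn.
  have [L4 _] := P24 Ln; split; first by apply: Lfun_le L4; rewrite ?ler1n ?ler_nat.
  rewrite exprS -mulrA iterS; apply: (le_trans _ (ler_wpM2l (ltW rho0) hn)).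
  rewrite -(@ler_pXn2r _ 2)// ?nnegrE ?mulr_ge0 ?Lpnorm_ge0 ?(ltW rho0)//.
  apply: (le_trans (spectral_gap bi N0 P24 Ln mn)).
  by rewrite exprMn ler_wpM2r ?sqr_ge0// rho2; lra.
move=> r r1; have [k [C C0 hC]] := bounded_to_L2 r1.
have [m [D D0 hD]] := bounded_from_L2 (ltW r1).
have [B B0 hB] := bounded_markov r1.
(* As [B + 1 >= 1], [E] dominates the bounds for all [n < m + k]. Division by [rho ^+ (m + k)] then
   pays for the iterates that do not contract. *)
pose E := (B + 1) ^+ (m + k).
have E0 : 0 <= E by rewrite exprn_ge0// addr_ge0.
exists ((D * C + E) / rho ^+ (m + k)).
  by rewrite divr_ge0 ?exprn_ge0 ?(ltW rho0)// addr_ge0// mulr_ge0.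
move=> n u Lu u0; have L1u : u \in Lfun mu 1%:E by apply: Lfun_le Lu => //; exact: ltW.
have DC0 : 0 <= D * C by exact: mulr_ge0.
have rn j : 0 < rho ^+ j by exact: exprn_gt0.
have [mkn|nmk] := leqP (m + k) n; last first.
  have [Ln hn] : iter n (markov_op P) u \in Lfun mu r%:E /\
      Lpnorm mu r (iter n (markov_op P) u) <= (B + 1) ^+ n * Lpnorm mu r u.
    elim: (n) => [|j [Lj hj]]; first by rewrite expr0 mul1r.
    have [Lj1 hj1] := hB _ Lj; split => //; rewrite (le_trans hj1)// exprS -mulrA.
    by apply: ler_pM => //; rewrite ?Lpnorm_ge0 ?lerDl.
  split => //; apply: (le_trans hn); rewrite ler_wpM2r ?Lpnorm_ge0//.
  rewrite mulrAC ler_pdivlMr//.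
  apply: (@le_trans _ _ (E * rho ^+ n)); last by rewrite ler_wpM2r ?(ltW (rn n))// lerDr.
  apply: ler_pM => //; [by rewrite exprn_ge0 ?addr_ge0|exact: ltW|..].
    by apply: ler_weXn2l; [rewrite lerDr|exact: ltnW].
  by apply: ler_wiXn2l; [exact: ltW|exact: ltW|exact: ltnW].
have -> : n = (m + ((n - (m + k)) + k))%N by rewrite addnCA subnK.
set j := (n - (m + k))%N.
have [Lk hk] := hC u Lu; have [_ mk] := iter_mean0 k L1u; rewrite u0 in mk.
have [Lj hj] := gap j _ Lk mk; have [Lm hm] := hD _ Lj.
rewrite iterD (iterD j); split => //.
apply: (le_trans hm); apply: (le_trans (ler_wpM2l D0 hj)).
apply: (le_trans (ler_wpM2l D0 (ler_wpM2l (ltW (rn j)) hk))).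
rewrite !mulrA ler_wpM2r ?Lpnorm_ge0//.
have -> : (D * C + E) / rho ^+ (m + k) * rho ^+ (m + (j + k)) = (D * C + E) * rho ^+ j.
  by rewrite addnCA (exprD _ j) mulrCA divfK ?gt_eqF// mulrC.
rewrite mulrAC; apply: ler_wpM2r; first exact: ltW.
by rewrite lerDl.
Qed.

End Smoothing.

(** * Completeness of L^r *)

(** Away from 0 the power is differentiable. At the limit 0 it is squeezed by [u n] itself, because
    [x^r <= x] for [x] in the unit interval and [r >= 1]. *)
Lemma cvg_powR {R : realType} (u : R^nat) (l r : R) : 1 <= r -> (forall n, 0 <= u n) ->
  u @ \oo --> l -> (fun n => u n `^ r) @ \oo --> l `^ r.
Proof.
move=> r1 u0 ul; have r0 : 0 < r by rewrite (lt_le_trans ltr01).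
have l0 : 0 <= l.
  by rewrite -(cvg_lim _ ul)//; apply: limr_ge; [by apply/cvg_ex; exists l|exact: nearW].
move: l0; rewrite le_eqVlt => /predU1P[l0|l0]; last first.
  have cont : {for l, continuous (@powR R ^~ r)}.
    apply: differentiable_continuous; apply/derivable1_diffP/derivable_powR.
    by rewrite in_itv/= l0.
  exact: (continuous_cvg _ cont ul).
rewrite -l0 powR0 ?gt_eqF//.
apply: (@squeeze_cvgr _ _ _ _ (fun=> 0) u); last 2 first.
- exact: cvg_cst.
- by rewrite l0.
near=> n; rewrite powR_ge0/=.
have un1 : u n <= 1.
  by near: n; apply: (cvgr_le l ul); rewrite -l0.
have := u0 n; rewrite le_eqVlt => /predU1P[<-|un0]; first by rewrite powR0// gt_eqF.
by apply: ge1r_powR => //; rewrite un0.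
Unshelve. all: by end_near. Qed.

Lemma limn_einf_le {R : realType} (u : (\bar R)^nat) c :
  (forall n, u n <= c)%E -> (limn_einf u <= c)%E.
Proof.
move=> uc; rewrite limn_einf_lim; apply: lime_le; first exact: is_cvg_einfs.
apply: nearW => n; apply: le_trans (uc n).
by apply: ereal_inf_lbound; exists n => /=.
Qed.

Section RieszFischer.
Context {d : measure_display} {S : measurableType d} {R : realType}.
Variable mu : probability S R.
Variables (r C rho : R) (w : nat -> S -> R).
Hypotheses (r1 : 1 <= r) (C0 : 0 <= C) (rho0 : 0 < rho) (rho1 : rho < 1).
Hypothesis Lw : forall n, w n \in Lfun mu r%:E.
Hypothesis hw : forall n, Lpnorm mu r (w n) <= C * rho ^+ n.

(** The tail from index [n] of the geometric series with terms [C * rho ^+ k]; the difference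
    [D n - D (n + m)] is exactly a finite block of it. *)
Let D n := C / (1 - rho) * rho ^+ n.

Lemma Lfun_partial_sum (v : nat -> S -> R) n m : (forall k, v k \in Lfun mu r%:E) ->
  (fun x => \sum_(n <= k < m) v k x) \in Lfun mu r%:E.
Proof.
move=> Lv; elim: m => [|m ih].
  under eq_fun do rewrite big_geq//; exact: (proj1 (Lpnorm_cst _ _ r1)).
have [nm|mn] := leqP n m.
  under eq_fun do rewrite big_nat_recr//=; exact: (proj1 (LpnormD r1 ih (Lv m))).
by under eq_fun do rewrite big_geq//; exact: (proj1 (Lpnorm_cst _ _ r1)).
Qed.

Let tail_sum n m : Lpnorm mu r (fun x => \sum_(n <= k < n + m) w k x) <= D n - D (n + m).
Proof.
elim: m => [|m ih].
  rewrite addn0 subrr; under eq_fun do rewrite big_geq//.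
  by rewrite (le_trans (proj2 (Lpnorm_cst mu 0 r1)))// normr0.
under eq_fun do rewrite addnS big_nat_recr ?leq_addr//=.
apply: (le_trans (proj2 (LpnormD r1 (Lfun_partial_sum n (n + m) Lw) (Lw (n + m)%N)))).
apply: (le_trans (lerD ih (hw (n + m)))).
rewrite addnS /D [rho ^+ _.+1]exprS.
rewrite le_eqVlt; apply/orP; left; apply/eqP; field.
by rewrite subr_eq0 gt_eqF.
Qed.

Let D_ge0 n : 0 <= D n.
Proof. by rewrite mulr_ge0 ?divr_ge0 ?exprn_ge0 ?subr_ge0// ltW. Qed.

Let mw k : measurable_fun setT (w k).
Proof. exact: measurable_Lfun (Lw k). Qed.

Let h x := (\sum_(0 <= k <oo) `|w k x|%:E)%E.

Let mh : measurable_fun setT h.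
Proof.
apply: ge0_emeasurable_sum => [k x _ _|k _]; first by rewrite lee_fin.
by apply/measurable_EFinP/measurableT_comp.
Qed.

(** L^r embeds in L^1, where the norms of the [w k] are summable; exchanging sum and integral makes
    [h] integrable. *)
Let ae_finite : {ae mu, forall x, (h x < +oo)%E}.
Proof.
have [K K0 hK] := Lpnorm_embed mu (lexx 1) r1.
have mw' k : measurable_fun setT (EFin \o (fun x => `|w k x|)).
  by apply/measurable_EFinP/measurableT_comp.
have Ih : mu.-integrable setT h.
  apply/integrableP; split; first exact: mh.
  under eq_integral => x _.
    rewrite gee0_abs; last by apply: nneseries_ge0 => k *; rewrite lee_fin.
    over.
  rewrite integral_nneseries//.
  apply: (@le_lt_trans _ _ (K * D 0)%:E); last exact: ltry.
  apply: lime_le; first by apply: is_cvg_nneseries => k _ _; exact: integral_ge0.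
  apply: nearW => n.
  apply: (@le_trans _ _ (\sum_(0 <= k < n) (K * (C * rho ^+ k))%:E)%E).
    apply: lee_sum => k _; have [L1 h1] := hK _ (Lw k).
    have -> : (\int[mu]_x `|w k x|%:E = (Lpnorm mu 1 (w k))%:E)%E by rewrite LpnormE// Lnorm1.
    by rewrite lee_fin (le_trans h1)// ler_wpM2l.
  rewrite sumEFin lee_fin -mulr_sumr ler_wpM2l//.
  suff -> : \sum_(0 <= k < n) C * rho ^+ k = D 0 - D n by rewrite gerBl.
  elim: n => [|n ih]; first by rewrite big_geq// subrr.
  rewrite big_nat_recr//= ih /D exprS; field.
  by rewrite subr_eq0 gt_eqF.
have := integrable_ae measurableT Ih.
by apply: filterS => x /(_ Logic.I); rewrite ltey_eq => ->.
Qed.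

(** Fatou carries the bound on finite blocks over to the tail of the series. The explicit rate is
    kept because the resolvent identities are later proved by errors of order [rho ^+ n]; the case
    [n = 0] puts [g] itself in L^r. *)
Lemma riesz_fischer : exists g, forall n,
  (fun x => g x - \sum_(0 <= k < n) w k x) \in Lfun mu r%:E /\
  Lpnorm mu r (fun x => g x - \sum_(0 <= k < n) w k x) <= C / (1 - rho) * rho ^+ n.
Proof.
pose E := [set x | (h x < +oo)%E].
have mE : measurable E.
  have := mh measurableT (emeasurable_itv `]-oo, (+oo)%E[).
  rewrite setTI; congr measurable; apply/seteqP; split => x /=; rewrite in_itv//=.
(* The cut-off makes the partial sums converge at every point, so that their limit is measurable; it
   changes them only on a null set. *)
pose f n x := \1_E x * \sum_(0 <= k < n) w k x.
have mS n m : measurable_fun setT (fun x => \sum_(n <= k < m) w k x).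
  exact: measurable_Lfun (Lfun_partial_sum n m Lw).
have mf n : measurable_fun setT (f n).
  by apply: measurable_funM => //; exact: measurable_indic.
have scvg x : E x -> cvgn (fun n => \sum_(0 <= k < n) w k x).
  move=> Ex; apply: (@normed_cvg R R (fun k => w k x)).
  suff : cvgn (series (fun k => `|w k x|)) by [].
  apply: nondecreasing_is_cvgn.
    by apply/nondecreasing_seqP => n; rewrite seriesSr lerDl.
  exists (fine (h x)) => _ [n _ <-].
  have hx0 : (0 <= h x)%E by apply: nneseries_ge0 => k *; rewrite lee_fin.
  rewrite -lee_fin fineK ?ge0_fin_numE// /series/= -sumEFin.
  by apply: nneseries_lim_ge => k *; rewrite lee_fin.
have fcvg x : cvgn (f ^~ x).
  have [Ex|Ex] := pselect (E x).
    under eq_fun do rewrite /f indicE mem_set// mul1r; exact: scvg.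
  under eq_fun do rewrite /f indicE memNset// mul0r; exact: is_cvg_cst.
pose g x := limn (f ^~ x).
have mg : measurable_fun setT g.
  by apply: (measurable_fun_cvg mf) => x _; exact: fcvg.
exists g => n; apply: (@Lpnorm_le _ _ _ _ _ _ (D n)) => //; first exact: measurable_funB.
have fB m x : f (n + m)%N x - f n x = \1_E x * \sum_(n <= k < n + m) w k x.
  by rewrite /f -mulrBr (@big_cat_nat _ _ _ n)//= ?leq_addr// addrAC subrr add0r.
pose F m x := (`|f (n + m)%N x - f n x| `^ r)%:E.
rewrite (ae_eq_integral (fun x => (`|g x - f n x| `^ r)%:E))//; last 3 first.
- by apply/measurable_EFinP/measurable_powR_abs/measurable_funB.
- by apply/measurable_EFinP/measurable_powR_abs/measurable_funB.
- by apply: filterS ae_finite => x Ex _; rewrite /f indicE mem_set// mul1r.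
rewrite (eq_integral (fun x => limn_einf (F ^~ x))); last first.
  move=> x _; apply/esym; apply: (cvg_limn_einf_sup _).1.
  apply: cvg_EFin; first exact: nearW.
  apply: cvg_powR => //; apply: cvg_norm; apply: cvgB; last exact: cvg_cst.
  rewrite (_ : (fun m => f (n + m)%N x) = fun m => f (m + n)%N x); last first.
    by apply/funext => m; rewrite addnC.
  by rewrite (cvg_shiftn n (f ^~ x)); exact: fcvg.
apply: (le_trans (fatou _ _ _ _)) => //.
  by move=> m; apply/measurable_EFinP/measurable_powR_abs/measurable_funB.
  by move=> m x _; rewrite lee_fin powR_ge0.
apply: limn_einf_le => m.
apply: (@le_trans _ _ (\int[mu]_x (`|\sum_(n <= k < n + m) w k x| `^ r)%:E)%E).
  apply: ge0_le_int => //.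
  - by apply/measurable_powR_abs/measurable_funB.
  - exact: measurable_powR_abs.
  - move=> x; rewrite fB; apply: ge0_ler_powR; rewrite ?nnegrE// ?(le_trans ler01)//.
    by rewrite normrM ler_piMl// indicE; case: (_ \in _); rewrite ?normr1 ?normr0.
have Ls := Lfun_partial_sum n (n + m) Lw.
rewrite Lpnorm_int// lee_fin ge0_ler_powR ?nnegrE ?Lpnorm_ge0 ?D_ge0 ?(le_trans ler01)//.
by rewrite (le_trans (tail_sum n m))// gerBl D_ge0.
Qed.

End RieszFischer.

(** * Complex L^r *)

Section ComplexCoordinates.
Context {R : realType}.
Implicit Types a z w : R[i].

(** The right side nests two expressions of the form [c * u + v], the shape in which [markov_lin] is
    stated. *)
Lemma Re_affine a z w :
  complex.Re (a * z + w) =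
  complex.Re a * complex.Re z + (- complex.Im a * complex.Im z + complex.Re w).
Proof. by case: a z w => [? ?] [? ?] [? ?] /=; rewrite mulNr addrA. Qed.

Lemma Im_affine a z w :
  complex.Im (a * z + w) =
  complex.Re a * complex.Im z + (complex.Im a * complex.Re z + complex.Im w).
Proof. by case: a z w => [? ?] [? ?] [? ?] /=; rewrite addrA. Qed.

Lemma ReB z w : complex.Re (z - w) = complex.Re z - complex.Re w.
Proof. by case: z w => [? ?] [? ?]. Qed.

Lemma ImB z w : complex.Im (z - w) = complex.Im z - complex.Im w.
Proof. by case: z w => [? ?] [? ?]. Qed.

Lemma complex_ext z w : complex.Re z = complex.Re w -> complex.Im z = complex.Im w -> z = w.
Proof. by case: z w => [? ?] [? ?] /= -> ->. Qed.

Lemma normc_sqrt z : Normc.normc z = Num.sqrt (complex.Re z ^+ 2 + complex.Im z ^+ 2).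
Proof. by case: z. Qed.

Lemma normc_nneg z : 0 <= Normc.normc z.
Proof. by rewrite normc_sqrt sqrtr_ge0. Qed.

Lemma normc_opp z : Normc.normc (- z) = Normc.normc z.
Proof. by case: z => x y /=; rewrite !sqrrN. Qed.

Lemma Re_le_normc z : `|complex.Re z| <= Normc.normc z.
Proof. by rewrite normc_sqrt -sqrtr_sqr ler_wsqrtr// lerDl sqr_ge0. Qed.

Lemma Im_le_normc z : `|complex.Im z| <= Normc.normc z.
Proof. by rewrite normc_sqrt -sqrtr_sqr ler_wsqrtr// lerDr sqr_ge0. Qed.

Lemma normc_le_Re_Im z : Normc.normc z <= `|complex.Re z| + `|complex.Im z|.
Proof.
rewrite normc_sqrt -[leRHS]ger0_norm ?addr_ge0// -sqrtr_sqr ler_wsqrtr//.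
rewrite sqrrD !real_normK ?num_real// addrAC lerDl.
by rewrite mulrn_wge0// mulr_ge0.
Qed.

Lemma norm1_normc z : `|z| = 1 -> Normc.normc z = 1.
Proof. by move=> z1; have := normc_def z; rewrite z1; case: z {z1} => x y /= [] <-. Qed.

End ComplexCoordinates.

Section ComplexLp.
Context {d : measure_display} {S : measurableType d} {R : realType}.
Variable mu : probability S R.
Variable r : R.
Hypothesis r1 : 1 <= r.
Implicit Types (f g : S -> R[i]) (a : R[i]).

Definition coord_Lfun f : Prop :=
  (fun x => complex.Re (f x)) \in Lfun mu r%:E /\ (fun x => complex.Im (f x)) \in Lfun mu r%:E.

(* Equivalent to [LnormC]; preferred because [markov_opC] acts separately on the
   real and imaginary parts. *)
Definition coord_norm f : R :=
  Lpnorm mu r (fun x => complex.Re (f x)) + Lpnorm mu r (fun x => complex.Im (f x)).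

Local Notation LC := coord_Lfun.
Local Notation NC := coord_norm.

Lemma NC_ge0 f : 0 <= NC f.
Proof. by rewrite addr_ge0 ?Lpnorm_ge0. Qed.

Let mnormc f : measurable_fun setT (fun x => complex.Re (f x)) ->
  measurable_fun setT (fun x => complex.Im (f x)) ->
  measurable_fun setT (fun x => Normc.normc (f x)).
Proof.
move=> mR mI.
under eq_fun do rewrite normc_sqrt -powR12_sqrt ?addr_ge0 ?sqr_ge0//.
apply: (measurableT_comp (measurable_powR _)) => //.
by apply: measurable_funD; exact: measurable_funX.
Qed.

Lemma LC_normc f : LC f -> (fun x => Normc.normc (f x)) \in Lfun mu r%:E /\
  Lpnorm mu r (fun x => Normc.normc (f x)) <= NC f.
Proof.
move=> [LR LI].
have absL u : u \in Lfun mu r%:E -> (fun x => `|u x|) \in Lfun mu r%:E /\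
    Lpnorm mu r (fun x => `|u x|) <= Lpnorm mu r u.
  move=> Lu; apply: Lpnorm_le_ae => //.
    by apply: measurableT_comp => //; exact: measurable_Lfun Lu.
  by apply: aeW => x; rewrite normr_id.
have [LaR hR] := absL _ LR; have [LaI hI] := absL _ LI.
have [Ls hs] := LpnormD r1 LaR LaI.
have [||Ln hn] := Lpnorm_le_ae (u := fun x => Normc.normc (f x)) r1 Ls.
- by apply: mnormc; [exact: measurable_Lfun LR|exact: measurable_Lfun LI].
- apply: aeW => x; rewrite [leLHS]ger0_norm ?normc_nneg// [leRHS]ger0_norm ?addr_ge0//.
  exact: normc_le_Re_Im.
by split => //; rewrite (le_trans hn)// (le_trans hs)// lerD.
Qed.

Lemma LfunCP f : LfunC mu r%:E f <-> LC f.
Proof.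
split.
  move=> [mR mI fin].
  have Ln : (fun x => Normc.normc (f x)) \in Lfun mu r%:E.
    by apply/LfunP_lty; split => //; exact: mnormc.
  split.
    have [||//] := Lpnorm_le_ae (u := fun x => complex.Re (f x)) r1 Ln; first exact: mR.
    by apply: aeW => x; rewrite [leRHS]ger0_norm ?normc_nneg// Re_le_normc.
  have [||//] := Lpnorm_le_ae (u := fun x => complex.Im (f x)) r1 Ln; first exact: mI.
  by apply: aeW => x; rewrite [leRHS]ger0_norm ?normc_nneg// Im_le_normc.
move=> Lf; have [Ln _] := LC_normc Lf; case: Lf => LR LI.
split; [exact: measurable_Lfun LR|exact: measurable_Lfun LI|].
by case/LfunP_lty : Ln.
Qed.

Lemma LnormC_le f : LC f -> (LnormC mu r%:E f <= (NC f)%:E)%E.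
Proof.
by move=> /LC_normc[Ln hn]; rewrite /LnormC -[leLHS](LpnormE Ln) lee_fin.
Qed.

Lemma NC_le f : LC f -> ((NC f)%:E <= 2%:E * LnormC mu r%:E f)%E.
Proof.
move=> Lf; have [Ln hn] := LC_normc Lf; case: Lf => LR LI.
rewrite /LnormC -[X in (_ * X)%E](LpnormE Ln) -EFinM lee_fin /coord_norm mulrDl mul1r lerD//.
  apply: (proj2 (Lpnorm_le_ae r1 Ln (measurable_Lfun LR) _)).
  by apply: aeW => x; rewrite [leRHS]ger0_norm ?normc_nneg// Re_le_normc.
apply: (proj2 (Lpnorm_le_ae r1 Ln (measurable_Lfun LI) _)).
by apply: aeW => x; rewrite [leRHS]ger0_norm ?normc_nneg// Im_le_normc.
Qed.

(** [coord_norm] is not homogeneous for complex scalars: [a] mixes the coordinates, and the bound on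
    [|Re a| + |Im a|] costs the factor 2. *)
Lemma LC_affine a f g : LC f -> LC g -> LC (fun x => a * f x + g x) /\
  NC (fun x => a * f x + g x) <= 2 * Normc.normc a * NC f + NC g.
Proof.
move=> [fR fI] [gR gI].
have [L1 h1] := LpnormZ_le (complex.Re a) r1 fR.
have [L2 h2] := LpnormZ_le (- complex.Im a) r1 fI.
have [L3 h3] := LpnormZ_le (complex.Re a) r1 fI.
have [L4 h4] := LpnormZ_le (complex.Im a) r1 fR.
have [L5 h5] := LpnormD r1 L2 gR; have [L6 h6] := LpnormD r1 L1 L5.
have [L7 h7] := LpnormD r1 L4 gI; have [L8 h8] := LpnormD r1 L3 L7.
have E1 : (fun x => complex.Re (a * f x + g x)) = fun x =>
    complex.Re a * complex.Re (f x) + (- complex.Im a * complex.Im (f x) + complex.Re (g x)).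
  by apply/funext => x; rewrite Re_affine.
have E2 : (fun x => complex.Im (a * f x + g x)) = fun x =>
    complex.Re a * complex.Im (f x) + (complex.Im a * complex.Re (f x) + complex.Im (g x)).
  by apply/funext => x; rewrite Im_affine.
rewrite /coord_Lfun /coord_norm E1 E2; split => //.
have nR := Lpnorm_ge0 mu r (fun x => complex.Re (f x)).
have nI := Lpnorm_ge0 mu r (fun x => complex.Im (f x)).
have := ler_wpM2r nR (Re_le_normc a); have := ler_wpM2r nI (Re_le_normc a).
have := ler_wpM2r nR (Im_le_normc a); have := ler_wpM2r nI (Im_le_normc a).
rewrite normrN in h2; lra.
Qed.

Lemma LC_congr f g : LC g -> measurable_fun setT (fun x => complex.Re (f x)) ->
  measurable_fun setT (fun x => complex.Im (f x)) -> ae_eqC mu f g -> LC f /\ NC f = NC g.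
Proof.
move=> [gR gI] mR mI fg.
have [|LR eR] := Lpnorm_congr r1 gR mR; first by apply: filterS fg => x ->.
have [|LI eI] := Lpnorm_congr r1 gI mI; first by apply: filterS fg => x ->.
by split => //; rewrite /coord_norm eR eI.
Qed.

Lemma NC_eq0 f : LC f -> NC f = 0 -> ae_eqC mu f (fun=> 0).
Proof.
move=> [fR fI] /eqP; rewrite paddr_eq0 ?Lpnorm_ge0// => /andP[/eqP f1 /eqP f2].
apply: filterS2 (Lpnorm_eq0 r1 fR f1) (Lpnorm_eq0 r1 fI f2) => x e1 e2.
exact: complex_ext.
Qed.

Lemma LC_cst a : LC (fun=> a) /\ NC (fun=> a) <= 2 * Normc.normc a.
Proof.
have [L1 h1] := Lpnorm_cst mu (complex.Re a) r1; have [L2 h2] := Lpnorm_cst mu (complex.Im a) r1.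
split => //; rewrite mulrDl mul1r; apply: lerD.
  exact: le_trans h1 (Re_le_normc a).
exact: le_trans h2 (Im_le_normc a).
Qed.

Lemma LC_sub f g : LC f -> LC g -> LC (fun x => f x - g x) /\
  NC (fun x => f x - g x) <= NC f + NC g.
Proof.
move=> [fR fI] [gR gI].
have [L1 h1] := LpnormB r1 fR gR; have [L2 h2] := LpnormB r1 fI gI.
have E1 : (fun x => complex.Re (f x - g x)) = fun x => complex.Re (f x) - complex.Re (g x).
  by apply/funext => x; rewrite ReB.
have E2 : (fun x => complex.Im (f x - g x)) = fun x => complex.Im (f x) - complex.Im (g x).
  by apply/funext => x; rewrite ImB.
by rewrite /coord_Lfun /coord_norm E1 E2; split => //; rewrite addrACA lerD.
Qed.

End ComplexLp.

(** * The resolvent *)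

Section AffineOperators.
Context {d : measure_display} {S : measurableType d} {R : realType}.
Variables (mu : probability S R) (r : R).
Hypothesis r1 : 1 <= r.
Local Notation LC := (coord_Lfun mu r).
Local Notation NC := (coord_norm mu r).
Implicit Types (f g : S -> R[i]) (a : R[i]) (A B : (S -> R[i]) -> S -> R[i]).

Lemma LC_scale a f : LC f -> LC (fun x => a * f x) /\
  NC (fun x => a * f x) <= 2 * Normc.normc a * NC f.
Proof.
move=> Lf; have [L0 h0] := LC_cst mu r1 0; have [L h] := LC_affine r1 a Lf L0.
have E : (fun x => a * f x + 0) = fun x => a * f x by apply/funext => x; rewrite addr0.
rewrite E in L h; split => //; apply: (le_trans h).
by rewrite gerDl (le_trans h0)// Normc.normc0 mulr0.
Qed.

Lemma LC_add f g : LC f -> LC g -> LC (fun x => f x + g x).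
Proof.
move=> Lf Lg; have [+ _] := LC_affine r1 1 Lf Lg.
by rewrite (_ : (fun x => 1 * f x + g x) = fun x => f x + g x)//; apply/funext => x; rewrite mul1r.
Qed.

Lemma LC_sum (F : nat -> S -> R[i]) n : (forall k, LC (F k)) ->
  LC (fun x => \sum_(0 <= k < n) F k x).
Proof.
move=> LF; elim: n => [|n ih].
  by under eq_fun do rewrite big_geq//; exact: (proj1 (LC_cst mu r1 0)).
under eq_fun do rewrite big_nat_recr//=.
exact: LC_add.
Qed.

(** Additivity and homogeneity in a single law, in the form that [bounded_operator] requires. *)
Definition affine_ae A := forall a f g, LC f -> LC g ->
  ae_eqC mu (A (fun x => a * f x + g x)) (fun x => a * A f x + A g x).

(** With factor -1 and both arguments 0, the law says that [A 0] equals [- A 0 + A 0]. *)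
Lemma affine_ae0 A : affine_ae A -> ae_eqC mu (A (fun=> 0)) (fun=> 0).
Proof.
move=> hA; have [L0 _] := LC_cst mu r1 0.
apply: filterS (hA (-1) _ _ L0 L0) => x.
rewrite (_ : (fun=> -1 * 0 + 0) = fun=> 0); last by apply/funext => y; rewrite mulr0 addr0.
by rewrite mulN1r addNr.
Qed.

Lemma affine_ae_scale A a f : affine_ae A -> LC f ->
  ae_eqC mu (A (fun x => a * f x)) (fun x => a * A f x).
Proof.
move=> hA Lf; have [L0 _] := LC_cst mu r1 0.
apply: filterS2 (hA a f _ Lf L0) (affine_ae0 hA) => x.
rewrite (_ : (fun y => a * f y + 0) = fun y => a * f y); last by apply/funext => y; rewrite addr0.
by move=> -> ->; rewrite addr0.
Qed.

Lemma affine_ae_add A f g : affine_ae A -> LC f -> LC g ->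
  ae_eqC mu (A (fun x => f x + g x)) (fun x => A f x + A g x).
Proof.
move=> hA Lf Lg; apply: filterS (hA 1 f g Lf Lg) => x.
rewrite (_ : (fun y => 1 * f y + g y) = fun y => f y + g y); last first.
  by apply/funext => y; rewrite mul1r.
by rewrite mul1r.
Qed.

Lemma affine_ae_sub A f g : affine_ae A -> LC f -> LC g ->
  ae_eqC mu (A (fun x => f x - g x)) (fun x => A f x - A g x).
Proof.
move=> hA Lf Lg; apply: filterS (hA (-1) g f Lg Lf) => x.
rewrite (_ : (fun y => -1 * g y + f y) = fun y => f y - g y); last first.
  by apply/funext => y; rewrite mulN1r addrC.
by rewrite mulN1r [RHS]addrC.
Qed.

End AffineOperators.

Section Resolvent.
Context {d : measure_display} {S : measurableType d} {R : realType}.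
Variables (mu : probability S R) (P : R.-pker S ~> S).
Hypothesis bi : bistochastic mu P.
Variables (r C rho : R).
Hypotheses (r1 : 1 <= r) (C0 : 0 <= C) (rho0 : 0 < rho) (rho1 : rho < 1).
Hypothesis bounded : bounded_iter mu P r r 1.
Hypothesis decay : forall n u, u \in Lfun mu r%:E -> \int[mu]_x u x = 0 ->
  iter n (markov_op P) u \in Lfun mu r%:E /\
  Lpnorm mu r (iter n (markov_op P) u) <= C * rho ^+ n * Lpnorm mu r u.
Variable lam : R[i].
Hypothesis lam1 : `|lam| = 1.
Local Notation LC := (coord_Lfun mu r).
Local Notation NC := (coord_norm mu r).
Local Notation PC := (markov_opC P).
Local Notation eqC := (ae_eqC mu).
Implicit Types (f g : S -> R[i]) (a : R[i]).

Let L1 u : u \in Lfun mu r%:E -> u \in Lfun mu 1%:E.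
Proof. exact: Lfun_le. Qed.

Let int1 u : u \in Lfun mu r%:E -> mu.-integrable setT (EFin \o u).
Proof. by move=> /L1 /Lfun1_integrable. Qed.

Lemma markovC_affine : affine_ae mu r PC.
Proof.
move=> a f g [fR fI] [gR gI].
have two (b c : R) (u v w : S -> R) :
    u \in Lfun mu r%:E -> v \in Lfun mu r%:E -> w \in Lfun mu r%:E ->
    {ae mu, forall x, markov_op P (fun y => b * u y + (c * v y + w y)) x =
       b * markov_op P u x + (c * markov_op P v x + markov_op P w x)}.
  move=> Lu Lv Lw; have [Lcv _] := LpnormZ_le c r1 Lv; have [Lvw _] := LpnormD r1 Lcv Lw.
  apply: filterS2 (markov_lin bi b (L1 Lu) (L1 Lvw)) (markov_lin bi c (L1 Lv) (L1 Lw)) => x.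
  by move=> -> ->.
apply: filterS2 (two (complex.Re a) (- complex.Im a) _ _ _ fR fI gR)
  (two (complex.Re a) (complex.Im a) _ _ _ fI fR gI) => x hR hI.
apply: complex_ext.
  rewrite Re_affine /= -hR; congr markov_op; apply/funext => y; exact: Re_affine.
rewrite Im_affine /= -hI; congr markov_op; apply/funext => y; exact: Im_affine.
Qed.

Lemma markovC_congr f g : LC f -> LC g -> eqC f g -> eqC (PC f) (PC g).
Proof.
move=> [fR fI] [gR gI] fg.
have [||hR hI] := (markov_congr bi (measurable_Lfun fR) (measurable_Lfun gR) _,
  markov_congr bi (measurable_Lfun fI) (measurable_Lfun gI) _).
- by apply: filterS fg => x ->.
- by apply: filterS fg => x ->.
by apply: filterS2 hR hI => x hR hI; exact: complex_ext.
Qed.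

Lemma markovC_bounded : exists2 B, 0 <= B & forall f, LC f -> LC (PC f) /\ NC (PC f) <= B * NC f.
Proof.
have [B B0 hB] := bounded; exists B => // f [fR fI].
have [LR hR] := hB _ fR; have [LI hI] := hB _ fI.
by split => //; rewrite mulrDr lerD.
Qed.

Lemma LC_markovC f : LC f -> LC (PC f).
Proof. by have [B _ h] := markovC_bounded; move=> /h[]. Qed.

Lemma LC_iter k f : LC f -> LC (iter k PC f).
Proof. by move=> Lf; elim: k => //= k; exact: LC_markovC. Qed.

Lemma Re_iter k f : (fun x => complex.Re (iter k PC f x)) =
  iter k (markov_op P) (fun x => complex.Re (f x)).
Proof. by elim: k => [//|k ih]; rewrite [RHS]iterS -ih. Qed.

Lemma Im_iter k f : (fun x => complex.Im (iter k PC f x)) =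
  iter k (markov_op P) (fun x => complex.Im (f x)).
Proof. by elim: k => [//|k ih]; rewrite [RHS]iterS -ih. Qed.

Lemma iter_congr k f g : LC f -> LC g -> eqC f g -> eqC (iter k PC f) (iter k PC g).
Proof.
move=> Lf Lg fg; elim: k => [//|k ih]; rewrite !iterS.
by apply: markovC_congr => //; exact: LC_iter.
Qed.

Lemma iter_affine k : affine_ae mu r (iter k PC).
Proof.
move=> a f g Lf Lg; elim: k => [|k ih]; first exact: aeW.
have [La _] := LC_affine r1 a Lf Lg.
have [Lb _] := LC_affine r1 a (LC_iter k Lf) (LC_iter k Lg).
apply: filterS2 (markovC_congr (LC_iter k La) Lb ih)
  (markovC_affine a (LC_iter k Lf) (LC_iter k Lg)) => x.
by rewrite !iterS => -> ->.
Qed.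

(** * The mean, and the splitting into constants and mean zero functions *)

Definition meanC f : R[i] :=
  Complex (\int[mu]_x complex.Re (f x)) (\int[mu]_x complex.Im (f x)).

Lemma meanC_affine a f g : LC f -> LC g ->
  meanC (fun x => a * f x + g x) = a * meanC f + meanC g.
Proof.
move=> [fR fI] [gR gI].
have two (b c : R) (u v w : S -> R) :
    u \in Lfun mu r%:E -> v \in Lfun mu r%:E -> w \in Lfun mu r%:E ->
    \int[mu]_x (b * u x + (c * v x + w x)) =
    b * \int[mu]_x u x + (c * \int[mu]_x v x + \int[mu]_x w x).
  move=> Lu Lv Lw; have [Lcv _] := LpnormZ_le c r1 Lv; have [Lvw _] := LpnormD r1 Lcv Lw.
  have [Lbu _] := LpnormZ_le b r1 Lu.
  by rewrite RintegralD ?int1// RintegralZl ?int1// RintegralD ?int1// RintegralZl ?int1.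
apply: complex_ext.
  rewrite Re_affine /= -two//; congr Rintegral; apply/funext => y; exact: Re_affine.
rewrite Im_affine /= -two//; congr Rintegral; apply/funext => y; exact: Im_affine.
Qed.

Lemma meanC_cst a : meanC (fun=> a) = a.
Proof.
by apply: complex_ext; rewrite /= /Rintegral int_cst.
Qed.

Lemma meanC_congr f g : LC f -> LC g -> eqC f g -> meanC f = meanC g.
Proof.
move=> [fR fI] [gR gI] fg; congr Complex; congr fine; apply: ae_eq_integral => //.
- exact/measurable_EFinP/(measurable_Lfun fR).
- exact/measurable_EFinP/(measurable_Lfun gR).
- by apply: filterS fg => x -> _.
- exact/measurable_EFinP/(measurable_Lfun fI).
- exact/measurable_EFinP/(measurable_Lfun gI).
- by apply: filterS fg => x -> _.
Qed.

Lemma meanC_markov f : LC f -> meanC (PC f) = meanC f.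
Proof. by move=> [fR fI]; congr Complex; rewrite -[RHS](integral_markov bi)//; exact: L1. Qed.

Lemma markovC_cst a : PC (fun=> a) = fun=> a.
Proof. by apply/funext => x; rewrite /markov_opC !markov_cst; case: a. Qed.

Lemma meanC_bounded : exists2 K, 0 <= K & forall f, LC f -> Normc.normc (meanC f) <= K * NC f.
Proof.
have [K K0 hK] := Lpnorm_embed mu (lexx 1) r1.
have hu u : u \in Lfun mu r%:E -> `|\int[mu]_x u x| <= K * Lpnorm mu r u.
  move=> Lu; apply: (le_trans (le_normr_Rintegral _ (int1 Lu))) => //.
  apply: le_trans (proj2 (hK u Lu)).
  by rewrite /Lpnorm Lnorm1.
exists K => // f [fR fI]; apply: (le_trans (normc_le_Re_Im _)).
by rewrite mulrDr; apply: lerD; exact: hu.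
Qed.

Definition center f x := f x - meanC f.

Lemma LC_center : exists2 K, 0 <= K & forall f, LC f -> LC (center f) /\ NC (center f) <= K * NC f.
Proof.
have [K K0 hK] := meanC_bounded; exists (1 + 2 * K).
  by rewrite addr_ge0// mulr_ge0.
move=> f Lf; have [Lm hm] := LC_cst mu r1 (meanC f).
have [L h] := LC_sub r1 Lf Lm; split => //; apply: (le_trans h).
rewrite mulrDl mul1r lerD2l (le_trans hm)// -mulrA.
by apply: ler_wpM2l => //; exact: hK.
Qed.

Lemma meanC_center f : LC f -> meanC (center f) = 0.
Proof.
move=> Lf; have [Lm _] := LC_cst mu r1 (- meanC f).
have -> : center f = fun x => 1 * f x + - meanC f by apply/funext => x; rewrite mul1r.
by rewrite meanC_affine// meanC_cst mul1r subrr.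
Qed.

Lemma center_affine a f g : LC f -> LC g ->
  center (fun x => a * f x + g x) = fun x => a * center f x + center g x.
Proof.
by move=> Lf Lg; apply/funext => x; rewrite /center meanC_affine//; ring.
Qed.

Lemma center_markovC f : LC f -> eqC (center (PC f)) (PC (center f)).
Proof.
move=> Lf; have [Lm _] := LC_cst mu r1 (meanC f).
apply: filterS (affine_ae_sub markovC_affine Lf Lm) => x.
by rewrite /center meanC_markov// markovC_cst => ->.
Qed.

Lemma iter_center_decay : exists2 K, 0 <= K & forall n f, LC f ->
  NC (iter n PC (center f)) <= K * rho ^+ n * NC f.
Proof.
have [K K0 hK] := LC_center; exists (C * K); first exact: mulr_ge0.
move=> n f Lf; have [Lc hc] := hK f Lf.
have [m1 m2] : \int[mu]_x complex.Re (center f x) = 0 /\ \int[mu]_x complex.Im (center f x) = 0.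
  by have [-> ->] := meanC_center Lf.
case: (Lc) => LR LI; rewrite /coord_norm Re_iter Im_iter.
apply: (@le_trans _ _ (C * rho ^+ n * NC (center f))).
  by rewrite mulrDr; apply: lerD; [case: (decay n LR m1)|case: (decay n LI m2)].
rewrite (_ : C * K * rho ^+ n * _ = C * rho ^+ n * (K * NC f)); last by rewrite /coord_norm; ring.
by rewrite ler_wpM2l// mulr_ge0// exprn_ge0// ltW.
Qed.

(** Terms of the expansion of the inverse of [lam - P]. As [lam] is unimodular, all decay must come
    from the iterates; [P] fixes constants, so these are removed by [center] beforehand. *)
Definition neumann_term f k x : R[i] := lam^-1 ^+ k.+1 * iter k PC (center f) x.

Definition neumann_sum f n x : R[i] := \sum_(0 <= k < n) neumann_term f k x.

Let lam0 : lam != 0.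
Proof. by rewrite -normr_eq0 lam1 oner_eq0. Qed.

Let normc_lamX k : Normc.normc (lam^-1 ^+ k) = 1.
Proof. by apply: norm1_normc; rewrite normrX normfV lam1 invr1 expr1n. Qed.

Let LCc f : LC f -> LC (center f).
Proof. by have [K _ h] := LC_center; case/h. Qed.

Lemma LC_term f k : LC f -> LC (neumann_term f k).
Proof. by move=> Lf; exact: (proj1 (LC_scale r1 _ (LC_iter k (LCc Lf)))). Qed.

Lemma LC_neumann f n : LC f -> LC (neumann_sum f n).
Proof. by move=> Lf; apply: (LC_sum r1) => k; exact: LC_term. Qed.

Lemma neumannS f n : neumann_sum f n.+1 =
  fun x => lam^-1 ^+ n.+1 * iter n PC (center f) x + neumann_sum f n x.
Proof. by apply/funext => x; rewrite /neumann_sum big_nat_recr//= addrC. Qed.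

Lemma neumann0 f : neumann_sum f 0 = fun=> 0.
Proof. by apply/funext => x; rewrite /neumann_sum big_geq. Qed.

Lemma neumann_affine n : affine_ae mu r (neumann_sum^~ n).
Proof.
move=> a f g Lf Lg; elim: n => [|n ih].
  by rewrite !neumann0; apply: aeW => x; rewrite mulr0 addr0.
apply: filterS2 ih (iter_affine n a (LCc Lf) (LCc Lg)) => x h1 h2.
by rewrite !neumannS center_affine// h1 h2; ring.
Qed.

Lemma neumann_congr f g n : LC f -> LC g -> eqC f g -> eqC (neumann_sum f n) (neumann_sum g n).
Proof.
move=> Lf Lg fg; elim: n => [|n ih]; first by rewrite !neumann0; exact: aeW.
have cfg : eqC (center f) (center g).
  have m := meanC_congr Lf Lg fg.
  by apply: filterS fg => x; rewrite /center m => ->.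
apply: filterS2 ih (iter_congr n (LCc Lf) (LCc Lg) cfg) => x h1 h2.
by rewrite !neumannS h1 h2.
Qed.

(** [lam] times the term of index [k + 1] equals [P] of the term of index [k], so only the two ends
    survive. *)
Lemma neumann_telescope f n : LC f ->
  eqC (fun x => lam * neumann_sum f n x - PC (neumann_sum f n) x)
      (fun x => center f x - lam^-1 ^+ n * iter n PC (center f) x).
Proof.
move=> Lf; elim: n => [|n ih].
  by rewrite neumann0 markovC_cst; apply: aeW => x; rewrite expr0 mul1r mulr0 !subrr.
rewrite neumannS.
have h := markovC_affine (lam^-1 ^+ n.+1) (LC_iter n (LCc Lf)) (LC_neumann n Lf).
apply: filterS2 ih h => x e1 ->; rewrite iterS.
have -> : lam * (lam^-1 ^+ n.+1 * iter n PC (center f) x + neumann_sum f n x) =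
    lam^-1 ^+ n * iter n PC (center f) x + lam * neumann_sum f n x.
  by rewrite mulrDr mulrA exprS mulVKf.
rewrite (_ : _ + _ - _ = lam^-1 ^+ n * iter n PC (center f) x +
  (lam * neumann_sum f n x - PC (neumann_sum f n) x) -
  lam^-1 ^+ n.+1 * PC (iter n PC (center f)) x); last by ring.
by rewrite e1; ring.
Qed.

Lemma neumann_markovC f n : LC f -> eqC (neumann_sum (PC f) n) (PC (neumann_sum f n)).
Proof.
move=> Lf; elim: n => [|n ih].
  by rewrite !neumann0 markovC_cst; exact: aeW.
rewrite !neumannS.
have h := markovC_affine (lam^-1 ^+ n.+1) (LC_iter n (LCc Lf)) (LC_neumann n Lf).
have h' := iter_congr n (LCc (LC_markovC Lf)) (LC_markovC (LCc Lf)) (center_markovC Lf).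
apply: filterS3 ih h h' => x -> -> ->.
by rewrite -iterSr iterS.
Qed.

(** Convergence of the Neumann series of [f] to [g] at the fixed rate [rho], with a free constant.
    Limits are thereby handled by inequalities alone, with [vanish] as the only passage to the
    limit. *)
Definition neumann_limit f g := exists2 K : R, 0 <= K & forall n,
  LC (fun x => g x - neumann_sum f n x) /\
  NC (fun x => g x - neumann_sum f n x) <= K * rho ^+ n.

Let vanish (x K : R) : 0 <= x -> (forall n, x <= K * rho ^+ n) -> x = 0.
Proof.
move=> x0 h; apply/eqP; rewrite eq_le x0 andbT.
have nrho : `|rho| < 1 by rewrite ger0_norm// ltW.
have cv := cvg_geometric K nrho.
rewrite -(cvg_lim _ cv)//; apply: limr_ge; first by apply/cvg_ex; exists 0.
exact: nearW.
Qed.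

(** Unlike in [neumann_limit], the constant is linear in the norm of [f]; this is what makes the
    resolvent bounded. *)
Lemma neumann_limit_ex : exists2 M, 0 <= M & forall f, LC f -> exists g, forall n,
  LC (fun x => g x - neumann_sum f n x) /\
  NC (fun x => g x - neumann_sum f n x) <= M * NC f * rho ^+ n.
Proof.
have [K K0 hK] := iter_center_decay.
have d0 : 0 < 1 - rho by rewrite subr_gt0.
(* One factor 2 comes from [LC_scale] applied to each term, the other from adding the two
   coordinates. *)
exists (4 * K / (1 - rho)); first by rewrite divr_ge0 ?mulr_ge0// ltW.
move=> f Lf.
have hw k : NC (neumann_term f k) <= 2 * K * NC f * rho ^+ k.
  apply: (le_trans (proj2 (LC_scale r1 _ (LC_iter k (LCc Lf))))).
  rewrite normc_lamX mulr1 (_ : 2 * K * _ * _ = 2 * (K * rho ^+ k * NC f)); last by ring.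
  by apply: ler_wpM2l => //; exact: hK.
have c0 : 0 <= 2 * K * NC f by rewrite !mulr_ge0// NC_ge0.
have [|gR hR] := riesz_fischer r1 c0 rho0 rho1 (fun k => proj1 (LC_term k Lf)).
  by move=> k; apply: (le_trans _ (hw k)); rewrite /coord_norm lerDl Lpnorm_ge0.
have [|gI hI] := riesz_fischer r1 c0 rho0 rho1 (fun k => proj2 (LC_term k Lf)).
  by move=> k; apply: (le_trans _ (hw k)); rewrite /coord_norm lerDr Lpnorm_ge0.
exists (fun x => Complex (gR x) (gI x)) => n.
have ReS x : complex.Re (neumann_sum f n x) = \sum_(0 <= k < n) complex.Re (neumann_term f k x).
  by apply: (big_morph (@complex.Re R)) => // [[? ?] [? ?]].
have ImS x : complex.Im (neumann_sum f n x) = \sum_(0 <= k < n) complex.Im (neumann_term f k x).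
  by apply: (big_morph (@complex.Im R)) => // [[? ?] [? ?]].
have [LR nR] := hR n; have [LI nI] := hI n.
have E1 : (fun x => complex.Re (Complex (gR x) (gI x) - neumann_sum f n x)) =
    fun x => gR x - \sum_(0 <= k < n) complex.Re (neumann_term f k x).
  by apply/funext => x; rewrite ReB ReS.
have E2 : (fun x => complex.Im (Complex (gR x) (gI x) - neumann_sum f n x)) =
    fun x => gI x - \sum_(0 <= k < n) complex.Im (neumann_term f k x).
  by apply/funext => x; rewrite ImB ImS.
rewrite {1}/coord_Lfun {1}/coord_norm E1 E2; split => //; apply: (le_trans (lerD nR nI)).
rewrite le_eqVlt; apply/orP; left; apply/eqP; field.
by rewrite gt_eqF.
Qed.

Lemma neumann_limit_LC f g : neumann_limit f g -> LC g.
Proof.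
move=> [K _ h]; have [L _] := h 0%N.
by rewrite neumann0 (_ : (fun x => g x - 0) = g) in L; last by apply/funext => x; rewrite subr0.
Qed.

Let LC_ae f g : LC g -> LC f -> eqC f g -> NC f = NC g.
Proof.
move=> Lg [fR fI] fg.
exact: (proj2 (LC_congr r1 Lg (measurable_Lfun fR) (measurable_Lfun fI) fg)).
Qed.

(** The difference of the limits is bounded by [(K + K') rho^n] for every [n]. Comparing partial
    sums only almost everywhere lets the lemma also show that the resolvent respects almost
    everywhere equality. *)
Lemma neumann_limit_unique f f' g g' : (forall n, eqC (neumann_sum f n) (neumann_sum f' n)) ->
  neumann_limit f g -> neumann_limit f' g' -> eqC g g'.
Proof.
move=> ff' fg fg'; have Lg := neumann_limit_LC fg; have Lg' := neumann_limit_LC fg'.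
have [Ld _] := LC_sub r1 Lg Lg'.
case: fg => K K0 hK; case: fg' => K' K'0 hK'.
have : NC (fun x => g x - g' x) = 0.
  apply: (@vanish _ (K + K')); first exact: NC_ge0.
  move=> n; have [L h] := hK n; have [L' h'] := hK' n.
  have [Lb hb] := LC_sub r1 L L'.
  rewrite (LC_ae Lb Ld); first by rewrite (le_trans hb)// mulrDl lerD.
  by apply: filterS (ff' n) => x ->; ring.
by move/(NC_eq0 r1 Ld); apply: filterS => x /eqP; rewrite subr_eq0 => /eqP.
Qed.

Lemma neumann_limit_affine a f f' g g' : LC f -> LC f' ->
  neumann_limit f g -> neumann_limit f' g' ->
  neumann_limit (fun x => a * f x + f' x) (fun x => a * g x + g' x).
Proof.
move=> Lf Lf' fg fg'; have Lg := neumann_limit_LC fg; have Lg' := neumann_limit_LC fg'.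
have [La _] := LC_affine r1 a Lf Lf'; have [Lag _] := LC_affine r1 a Lg Lg'.
case: fg => K K0 hK; case: fg' => K' K'0 hK'.
exists (2 * Normc.normc a * K + K').
  by rewrite addr_ge0// !mulr_ge0// normc_nneg.
move=> n; have [L h] := hK n; have [L' h'] := hK' n.
have [Lc hc] := LC_affine r1 a L L'.
have [Ld _] := LC_sub r1 Lag (LC_neumann n La).
split => //; rewrite (LC_ae Lc Ld).
  apply: (le_trans hc); rewrite (mulrDl (2 * Normc.normc a * K)); apply: lerD => //.
  by rewrite -[leRHS]mulrA ler_wpM2l// mulr_ge0// normc_nneg.
by apply: filterS (neumann_affine n a Lf Lf') => x ->; ring.
Qed.

(** The right inverse property. [lam - P] is bounded, so it keeps the error [g - neumann_sum f n] of
    order [rho ^+ n]; the remainder left by [neumann_telescope] is of the same order. *)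
Lemma neumann_limit_resolvent f g : LC f -> neumann_limit f g ->
  eqC (fun x => lam * g x - PC g x) (center f).
Proof.
move=> Lf fg; have Lg := neumann_limit_LC fg.
have [Llg _] := LC_scale r1 lam Lg.
have [Lh _] := LC_sub r1 (proj1 (LC_sub r1 Llg (LC_markovC Lg))) (LCc Lf).
have [B B0 hB] := markovC_bounded; have [D D0 hD] := iter_center_decay.
case: fg => K K0 hK.
have : NC (fun x => lam * g x - PC g x - center f x) = 0.
  apply: (@vanish _ (2 * K + B * K + 2 * (D * NC f))); first exact: NC_ge0.
  move=> n; have [L h] := hK n; have LS := LC_neumann n Lf.
  have [L1' h1] := LC_scale r1 lam L; have [L2 h2] := hB _ L.
  have [L3 h3] := LC_scale r1 (lam^-1 ^+ n) (LC_iter n (LCc Lf)).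
  have [L4 h4] := LC_sub r1 L1' L2; have [L5 h5] := LC_sub r1 L4 L3.
  rewrite (LC_ae L5 Lh).
    apply: (le_trans h5); rewrite (mulrDl (2 * K + B * K)) (mulrDl (2 * K)); apply: lerD.
      apply: (le_trans h4); apply: lerD.
        apply: (le_trans h1); rewrite (norm1_normc lam1) mulr1 -mulrA.
        by apply: ler_wpM2l.
      by rewrite (le_trans h2)// -mulrA ler_wpM2l.
    apply: (le_trans h3); rewrite normc_lamX mulr1 -mulrA; apply: ler_wpM2l => //.
    by rewrite (le_trans (hD n f Lf))// mulrAC.
  apply: filterS2 (neumann_telescope n Lf) (affine_ae_sub markovC_affine Lg LS) => x e1 ->.
  rewrite (_ : center f x = lam * neumann_sum f n x - PC (neumann_sum f n) x +
     lam^-1 ^+ n * iter n PC (center f) x); last by rewrite e1 subrK.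
  by ring.
by move/(NC_eq0 r1 Lh); apply: filterS => x /eqP; rewrite subr_eq0 => /eqP.
Qed.

(** The left inverse property. The partial sums commute with [P], so those of [lam f - P f] are
    given by [neumann_telescope] and differ from [center f] by a term of order [rho ^+ n]. *)
Lemma neumann_limit_center f : LC f -> neumann_limit (fun x => lam * f x - PC f x) (center f).
Proof.
move=> Lf; have [D D0 hD] := iter_center_decay.
have [Llf _] := LC_scale r1 lam Lf; have LP := LC_markovC Lf.
have [Lh _] := LC_sub r1 Llf LP.
exists (2 * (D * NC f)); first by rewrite !mulr_ge0// NC_ge0.
move=> n; have [L3 h3] := LC_scale r1 (lam^-1 ^+ n) (LC_iter n (LCc Lf)).
have [L _] := LC_sub r1 (LCc Lf) (LC_neumann n Lh).
split => //; rewrite (LC_ae L3 L).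
  apply: (le_trans h3); rewrite normc_lamX mulr1 -mulrA; apply: ler_wpM2l => //.
  by rewrite (le_trans (hD n f Lf))// mulrAC.
have e1 := affine_ae_sub (neumann_affine n) Llf LP.
have e2 := affine_ae_scale r1 lam (neumann_affine n) Lf.
have e3 := neumann_markovC n Lf.
have {e2 e3}e1 : eqC (neumann_sum (fun x => lam * f x - PC f x) n)
    (fun x => lam * neumann_sum f n x - PC (neumann_sum f n) x).
  by apply: filterS3 e1 e2 e3 => x -> -> ->.
apply: filterS2 e1 (neumann_telescope n Lf) => x -> ->.
by rewrite opprB addrC subrK.
Qed.

Hypothesis lam_neq1 : lam != 1.

Lemma invertible_resolvent :
  invertible_operator mu r%:E (fun f x => lam * f x - markov_opC P f x).
Proof.
have lamB : lam - 1 != 0 by rewrite subr_eq0.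
have [M M0 hM] := neumann_limit_ex.
(* The hypothesis [LC f] is moved under the existential, so that choice yields a map on all
   functions. *)
have ex f : exists g, LC f -> forall n,
    LC (fun x => g x - neumann_sum f n x) /\
    NC (fun x => g x - neumann_sum f n x) <= M * NC f * rho ^+ n.
  have [Lf|nLf] := pselect (LC f); last by exists f.
  by have [g hg] := hM f Lf; exists g.
have [G hG] := choice ex.
have lim f : LC f -> neumann_limit f (G f).
  by move=> Lf; exists (M * NC f); [rewrite mulr_ge0 ?NC_ge0|exact: hG].
have LG f : LC f -> LC (G f) by move=> /lim; exact: neumann_limit_LC.
have NG f : LC f -> NC (G f) <= M * NC f.
  move=> Lf; have [_] := hG f Lf 0%N; rewrite neumann0 expr0 mulr1.
  by rewrite (_ : (fun x => G f x - 0) = G f)//; apply/funext => x; rewrite subr0.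
(* On constants [lam - P] is multiplication by [lam - 1], which accounts for the second summand. *)
pose T f x := G f x + meanC f / (lam - 1).
have LT f : LC f -> LC (T f) /\ NC (T f) <= NC (G f) + 2 * Normc.normc (meanC f / (lam - 1)).
  move=> Lf; have [Lc hc] := LC_cst mu r1 (- (meanC f / (lam - 1))).
  have [L h] := LC_sub r1 (LG f Lf) Lc.
  rewrite (_ : T f = fun x => G f x - - (meanC f / (lam - 1))).
    by split => //; apply: (le_trans h); rewrite lerD2l (le_trans hc)// normc_opp.
  by apply/funext => x; rewrite opprK.
exists T; last first.
  move=> f /(LfunCP mu r1) Lf.
  have [Llf _] := LC_scale r1 lam Lf; have LP := LC_markovC Lf.
  have [Lh _] := LC_sub r1 Llf LP.
  split.
    have mE : meanC (fun x => lam * f x - PC f x) = (lam - 1) * meanC f.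
      have -> : (fun x => lam * f x - PC f x) = fun x => -1 * PC f x + lam * f x.
        by apply/funext => x; rewrite mulN1r addrC.
      have [Lz _] := LC_cst mu r1 0.
      have -> : (fun x => -1 * PC f x + lam * f x) = (fun x => -1 * PC f x + (lam * f x + 0)).
        by apply/funext => x; rewrite addr0.
      rewrite meanC_affine//; last exact: (proj1 (LC_affine r1 lam Lf Lz)).
      rewrite meanC_affine// meanC_cst meanC_markov//; ring.
    apply: filterS (neumann_limit_unique (fun n => aeW _ (fun x => erefl))
      (lim _ Lh) (neumann_limit_center Lf)) => x e.
    by rewrite /T e mE mulrAC mulfV// mul1r /center subrK.
  have [Lc _] := LC_cst mu r1 (meanC f / (lam - 1)).
  have h := affine_ae_add markovC_affine (LG f Lf) Lc.
  apply: filterS2 h (neumann_limit_resolvent Lf (lim f Lf)) => x -> e.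
  rewrite markovC_cst /T.
  rewrite (_ : _ - _ = lam * G f x - PC (G f) x + meanC f / (lam - 1) * (lam - 1)); last by ring.
  by rewrite divfK// e /center subrK.
split.
- by move=> f /(LfunCP mu r1) Lf; apply/(LfunCP mu r1); case: (LT f Lf).
- move=> f g /(LfunCP mu r1) Lf /(LfunCP mu r1) Lg fg.
  have := neumann_limit_unique (fun n => neumann_congr n Lf Lg fg) (lim f Lf) (lim g Lg).
  by apply: filterS => x; rewrite /T (meanC_congr Lf Lg fg) => ->.
- move=> a f g /(LfunCP mu r1) Lf /(LfunCP mu r1) Lg.
  have [La _] := LC_affine r1 a Lf Lg.
  have := neumann_limit_unique (fun n => aeW _ (fun x => erefl)) (lim _ La)
    (neumann_limit_affine a Lf Lg (lim f Lf) (lim g Lg)).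
  by apply: filterS => x; rewrite /T meanC_affine// => ->; ring.
have [K K0 hK] := meanC_bounded.
pose c := Normc.normc (lam - 1)^-1.
have c0 : 0 <= c by exact: normc_nneg.
exists ((M + 2 * (K * c)) * 2) => f /(LfunCP mu r1) Lf.
have [L h] := LT f Lf.
apply: (le_trans (LnormC_le r1 L)).
rewrite EFinM -muleA.
apply: (@le_trans _ _ ((M + 2 * (K * c))%:E * (NC f)%:E)%E); last first.
  by apply: lee_wpmul2l; [rewrite lee_fin addr_ge0// !mulr_ge0|exact: NC_le].
rewrite -EFinM lee_fin (le_trans h)// (mulrDl M); apply: lerD; first exact: NG.
rewrite -mulrA ler_wpM2l// Normc.normcM -/c mulrAC ler_wpM2r// hK//.
Qed.

End Resolvent.

Unset Implicit Arguments.

Theorem theorem5p1 (d : measure_display) (S : measurableType d) (R : realType)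
    (mu : probability S R) (P : R.-pker S ~> S)
    (hyperP : hyperbounded mu P) (ergP : ergodic mu P)
    (P24 : maps_Lp mu P 2%:E 4%:E)
    (normP : (opnorm mu P 2%:E 4%:E < (2 `^ 4^-1)%:E)%E) :
  aperiodic mu P.
Proof.
have [bi _] := hyperP.
have N0' := opnorm_ge0 P24.
have Nfin : (opnorm mu P 2%:E 4%:E < +oo)%E := lt_trans normP (ltry _).
have N24 := opnorm_bound bi P24 Nfin.
have N0 : 0 <= fine (opnorm mu P 2%:E 4%:E) by exact: fine_ge0.
have N2 : fine (opnorm mu P 2%:E 4%:E) ^+ 4 < 2.
  have h : fine (opnorm mu P 2%:E 4%:E) < 2 `^ 4^-1.
    by rewrite -lte_fin fineK// ge0_fin_numE.
  move: N0 h; move: (fine _) => N N0 h; rewrite -powR_mulrn//.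
  have -> : 2 = (2 `^ 4^-1) `^ 4%:R :> R by rewrite -powRrM mulVf// powRr1.
  by apply: gt0_ltr_powR; rewrite ?nnegrE ?powR_ge0.
have [rho /andP[rho0 rho1] decay] := geometric_decay bi N0 N24 N2.
move=> r r1; split => //.
(* What remains is that a unimodular [l] other than 1 is outside the spectrum; positivity and
   minimality of the period 1 are immediate. *)
move=> l [spec l1]; rewrite expr1; apply/eqP/negPn/negP => lN1; apply: spec.
have [C C0 hC] := decay r r1.
have B := bounded_markov bi N0 N24 r1.
exact: (invertible_resolvent bi (ltW r1) C0 rho0 rho1 B hC l1 lN1).
Qed.
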